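(* (Echo State Mapping Theorem) Let $M$ be a compact $m$-manifold, $n\in\mathbb{N}$, $\phi\in\mathrm{Diff}^1(M)$ and $\omega\in C^1(M,\mathbb{R})$. Let $(\varphi,A,W^{\mathrm{in}})$ be an Echo State Network of size $n$ (so $A$ is a real $n\times n$ matrix and $W^{\mathrm{in}}$ a real $n\times 1$ matrix), and assume $\lVert A\rVert_2<\min(1,\,1/\lVert D\phi^{-1}\rVert_\infty)$. For $r_0\in I_n=[-1,1]^n$ define functions $f^{r_0}_k:M\to I_n$, $k\in\mathbb{N}_0$, by $f^{r_0}_0(x)=r_0$ and $$f^{r_0}_{k+1}(x)=\varphi\big(A\,f^{r_0}_k(\phi^{-1}(x))+W^{\mathrm{in}}\omega(x)\big).$$ Then there exists a unique solution $f\in C^1(M,\mathbb{R}^n)$ of the equation $$f=\varphi\big(A\,f\circ\phi^{-1}+W^{\mathrm{in}}\omega\big),$$ and for all $r_0\in I_n$ the sequence $f^{r_0}_k$ converges to $f$ in the $C^1$ topology as $k\to\infty$.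
   Context: Echo State Network (ESN) of size $n$: let $\sigma\in C^1(\mathbb{R},(-1,1))$ have derivative taking values in $(0,1)$, let $b_1,\dots,b_n\in\mathbb{R}$, and let $I_n:=[-1,1]^n$. Define $\varphi:\mathbb{R}^n\to I_n$ by $\varphi_i(r)=\sigma(r_i+b_i)$ for $i=1,\dots,n$. An ESN of size $n$ is a triple $(\varphi,A,W^{\mathrm{in}})$ with $\varphi$ of this form, $A$ a real $n\times n$ matrix and $W^{\mathrm{in}}$ a real $n\times1$ matrix. $\mathrm{Diff}^1(M)$ is the set of $C^1$ diffeomorphisms of $M$ onto itself. Manifolds are smooth and without boundary. $\lVert A\rVert_2$ is the matrix 2-norm (operator norm for the Euclidean norm). $\lVert\cdot\rVert_\infty$ is the supremum norm; for derivatives it is the supremum over $M$ of the operator norm with respect to a fixed Riemannian metric on $M$ (and the Euclidean norm on $\mathbb{R}^n$). The $C^1$ norm is $\lVert f\rVert_{C^1}:=\lVert f\rVert_\infty+\lVert Df\rVert_\infty$, and the $C^1$ topology is the one induced by this norm. *)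

(* Defs.v *)
From HB Require Import structures.
From mathcomp Require Import all_boot all_order all_algebra.
From mathcomp Require Import all_classical all_reals all_analysis.
Set Implicit Arguments.
Unset Strict Implicit.
Unset Printing Implicit Defensive.
Import Order.TTheory GRing.Theory Num.Theory.
Import numFieldNormedType.Exports.
Local Open Scope classical_set_scope.
Local Open Scope ring_scope.

(* Vectors of R^k are columns 'cV[R]_k.  The library norm on 'cV[R]_k is the
   max norm; it is used only for its topology and for differentiability, and all
   quantitative statements go through [enorm]. *)

Definition enorm (R : realType) (k : nat) (v : 'cV[R]_k) : R :=
  Num.sqrt (\sum_(i < k) v i 0 ^+ 2).

Definition opnorm (R : realType) (p q : nat)
    (normp : 'cV[R]_p -> R) (normq : 'cV[R]_q -> R)
    (T : 'cV[R]_p -> 'cV[R]_q) : \bar R :=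
  ereal_sup [set (normq (T v))%:E | v in [set v | normp v <= 1]].

Definition mxnorm2 (R : realType) (n : nat) (A : 'M[R]_n) : \bar R :=
  opnorm (@enorm R n) (@enorm R n) (fun v => A *m v).

(* Supremum in [0, +oo], so that the supremum of the empty set is 0. *)
Definition nnsup (R : realType) (X : set (\bar R)) : \bar R :=
  ereal_sup ([set 0%E] `|` X).

(* To be used with U open. As V is finite-dimensional in all uses below,
   continuity of x |-> 'd f x v for every v amounts to continuity of 'd f. *)
Fixpoint Ck_on (R : realType) (V W : normedModType R) (k : nat)
    (U : set V) (f : V -> W) : Prop :=
  match k with
  | 0%N => forall x, U x -> {for x, continuous f}
  | k'.+1 => (forall x, U x -> differentiable f x) /\
             (forall v, Ck_on k' U (fun x => 'd f x v))
  end.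

Definition smooth_on (R : realType) (V W : normedModType R)
    (U : set V) (f : V -> W) : Prop :=
  forall k, Ck_on k U f.

(* The values of [cmap] outside [cdom], and of [cinv] outside the image of
   [cdom], are irrelevant. *)
Record chart (R : realType) (m : nat) (M : topologicalType) := Chart {
  cdom : set M;
  cmap : M -> 'cV[R]_m;
  cinv : 'cV[R]_m -> M;
  cdom_open : open cdom;
  cimg_open : open (cmap @` cdom);
  cmapK : forall x, cdom x -> cinv (cmap x) = x;
  cmap_cont : forall x, cdom x -> {for x, continuous cmap};
  cinv_cont : forall y, (cmap @` cdom) y -> {for y, continuous cinv} }.

Definition cimg (R : realType) (m : nat) (M : topologicalType)
    (c : chart R m M) : set 'cV[R]_m :=
  cmap c @` cdom c.

(* Smooth m-manifolds without boundary; the atlas need not be maximal. *)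
Record manifold (R : realType) (m : nat) (M : topologicalType) := Manifold {
  atlas : set (chart R m M);
  manifold_hausdorff : hausdorff_space M;
  manifold_second_countable : @second_countable M;
  atlas_cover : forall x : M, exists2 c, atlas c & cdom c x;
  atlas_smooth : forall c d, atlas c -> atlas d ->
    smooth_on (cmap c @` (cdom c `&` cdom d)) (cmap d \o cinv c) }.

Definition C1_fun (R : realType) (m : nat) (M : topologicalType)
    (S : manifold R m M) (V : normedModType R) (f : M -> V) : Prop :=
  forall c, atlas S c -> Ck_on 1 (cimg c) (f \o cinv c).

Definition C1_map (R : realType) (m : nat) (M : topologicalType)
    (S : manifold R m M) (phi : M -> M) : Prop :=
  continuous phi /\
  forall c d, atlas S c -> atlas S d ->
    Ck_on 1 (cmap c @` (cdom c `&` phi @^-1` cdom d))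
            (cmap d \o phi \o cinv c).

Record diffeo1 (R : realType) (m : nat) (M : topologicalType)
    (S : manifold R m M) := Diffeo1 {
  diff_fun :> M -> M;
  diff_inv : M -> M;
  diff_funK : cancel diff_fun diff_inv;
  diff_invK : cancel diff_inv diff_fun;
  diff_fun_C1 : C1_map S diff_fun;
  diff_inv_C1 : C1_map S diff_inv }.

(* A tangent vector at x is represented by its components v : 'cV[R]_m in a
   chart c around x, and the metric by its Gram matrices in the charts;
   [gram_change] is the tensor transformation law. *)
Record riemannian_metric (R : realType) (m : nat) (M : topologicalType)
    (S : manifold R m M) := RiemannianMetric {
  gram : chart R m M -> M -> 'M[R]_m;
  gram_sym : forall c x, atlas S c -> cdom c x -> (gram c x)^T = gram c x;
  gram_posdef : forall c x (v : 'cV[R]_m), atlas S c -> cdom c x ->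
    v != 0 -> 0 < (v^T *m gram c x *m v) 0 0;
  gram_smooth : forall c, atlas S c -> smooth_on (cimg c) (gram c \o cinv c);
  gram_change : forall c d x (u v : 'cV[R]_m), atlas S c -> atlas S d ->
    cdom c x -> cdom d x ->
    let J : 'cV[R]_m -> 'cV[R]_m := 'd (cmap d \o cinv c) (cmap c x) in
    u^T *m gram c x *m v = (J u)^T *m gram d x *m J v }.

Definition tnorm (R : realType) (m : nat) (M : topologicalType)
    (S : manifold R m M) (g : riemannian_metric S)
    (c : chart R m M) (x : M) (v : 'cV[R]_m) : R :=
  Num.sqrt ((v^T *m gram g c x *m v) 0 0).

(* ||D phi||_oo for phi : M -> M. The operator norm at x does not depend on the
   charts c around x and d around phi x. *)
Definition supnormD_map (R : realType) (m : nat) (M : topologicalType)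
    (S : manifold R m M) (g : riemannian_metric S) (phi : M -> M) : \bar R :=
  nnsup [set y | exists c d x,
    [/\ atlas S c, atlas S d, cdom c x, cdom d (phi x) &
        y = opnorm (tnorm g c x) (tnorm g d (phi x))
                   ('d (cmap d \o phi \o cinv c) (cmap c x))]].

(* ||D f||_oo for f : M -> R^n. *)
Definition supnormD_fun (R : realType) (m : nat) (M : topologicalType)
    (S : manifold R m M) (g : riemannian_metric S)
    (n : nat) (f : M -> 'cV[R]_n) : \bar R :=
  nnsup [set y | exists c x,
    [/\ atlas S c, cdom c x &
        y = opnorm (tnorm g c x) (@enorm R n) ('d (f \o cinv c) (cmap c x))]].

Definition supnorm (R : realType) (M : Type) (n : nat)
    (f : M -> 'cV[R]_n) : \bar R :=
  nnsup (range (fun x => (enorm (f x))%:E)).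

Definition C1norm (R : realType) (m : nat) (M : topologicalType)
    (S : manifold R m M) (g : riemannian_metric S)
    (n : nat) (f : M -> 'cV[R]_n) : \bar R :=
  (supnorm f + supnormD_fun g f)%E.

(* Convergence in the space C^1(M, R^n). *)
Definition cvg_C1 (R : realType) (m : nat) (M : topologicalType)
    (S : manifold R m M) (g : riemannian_metric S)
    (n : nat) (u : nat -> M -> 'cV[R]_n) (f : M -> 'cV[R]_n) : Prop :=
  [/\ forall k, C1_fun S (u k), C1_fun S f &
      C1norm g (fun x => u k x - f x) @[k --> \oo] --> 0%E].

Definition cube (R : realType) (n : nat) : set 'cV[R]_n :=
  [set r | forall i, -1 <= r i 0 <= 1].

Definition activation (R : realType) (sigma : R -> R) : Prop :=
  [/\ forall t, derivable sigma t 1,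
      continuous (derive1 sigma),
      forall t, -1 < sigma t < 1 &
      forall t, 0 < derive1 sigma t < 1].

Definition esn_nonlinearity (R : realType) (n : nat)
    (vphi : 'cV[R]_n -> 'cV[R]_n) : Prop :=
  exists (sigma : R -> R) (b : 'I_n -> R),
    activation sigma /\ forall r i, vphi r i 0 = sigma (r i 0 + b i).

Record ESN (R : realType) (n : nat) := MkESN {
  esn_phi : 'cV[R]_n -> 'cV[R]_n;
  esn_A : 'M[R]_n;
  esn_Win : 'M[R]_(n, 1);
  esn_phiP : esn_nonlinearity esn_phi }.

(* The operator f |-> varphi (A f o phi^-1 + W^in omega). *)
Definition esn_op (R : realType) (m n : nat) (M : topologicalType)
    (S : manifold R m M) (E : ESN R n) (phi : diffeo1 S) (omega : M -> R)
    (f : M -> 'cV[R]_n) : M -> 'cV[R]_n :=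
  fun x => esn_phi E (esn_A E *m f (diff_inv phi x) + omega x *: esn_Win E).

Fixpoint esn_seq (R : realType) (m n : nat) (M : topologicalType)
    (S : manifold R m M) (E : ESN R n) (phi : diffeo1 S) (omega : M -> R)
    (r0 : 'cV[R]_n) (k : nat) : M -> 'cV[R]_n :=
  match k with
  | 0%N => fun=> r0
  | k'.+1 => esn_op E phi omega (esn_seq E phi omega r0 k')
  end.

(* Main.v *)
(* The operator f |-> varphi (A f o phi^-1 + W^in omega) is a contraction for the
   supremum norm, since varphi is 1-Lipschitz and a := ||A||_2 < 1.  Writing
   T for it, the chain rule gives
     D(T f)(x) = D varphi (..) (A Df(phi^-1 x) Dphi^-1(x) + W^in Domega(x)),
   so that for a fixed base point Df |-> D(T f) contracts by a L < 1, where
   L := ||Dphi^-1||_oo.  The derivative of varphi depends on f only through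
   sigma', which is merely uniformly continuous on bounded sets; hence, along the
   uniformly Cauchy sequence f_k,
     ||Df_{k+1} - Df_{l+1}|| <= eps + a L ||Df_k - Df_l||
   for k, l large, and (Df_k) is uniformly Cauchy too.  In charts this makes the
   pointwise limit C^1, with Df = lim Df_k.  Its independence of r_0 follows from
   uniqueness of the fixed point, for which boundedness of sigma suffices. *)

From HB Require Import structures.
Require Import Defs.
From mathcomp Require Import all_boot all_order all_algebra.
From mathcomp Require Import all_classical all_reals all_analysis.
From mathcomp Require Import ring lra.
Import Order.TTheory GRing.Theory Num.Theory.
Import numFieldNormedType.Exports.
Local Open Scope classical_set_scope.
Local Open Scope ring_scope.

Set Implicit Arguments.
Unset Strict Implicit.
Unset Printing Implicit Defensive.

(** * Differentials and germs *)

(** There is no tangent bundle to work in: [Df] exists only through differentials of chart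
    expressions. Derivative bounds are therefore pointwise inequalities between [enorm] and [tnorm],
    asked in all charts at once ([diff_bound]), and [gram_change] lets one chart suffice to prove
    them. The metric norm is compared with the max norm only locally, near a point of a chart; this
    is how metric estimates reach the theorem on limits of derivatives, which is about scalar
    functions on a ball of a normed space.

    In the recursion for [Df_k - Df_l], eps arises as a gap of sigma' multiplied by
    [||A Df_k Dphi^-1 + W^in Domega||], so a bound on [||Df_k||] uniform in k must come first. With
    W a bound for the derivative of [W^in omega], the estimate [||Df_{k+1}|| <= a L ||Df_k|| + W]
    preserves the bound C = W / (1 - a L), and [Df_0 = 0] satisfies it. The recursion is then run j
    times from an index N0 beyond which the gap is small; it starts from the crude bound 2C and
    leaves the error e/2 + (a L)^j 2C. *)

Lemma near_eq_continuous (T U : topologicalType) (f g : T -> U) (x : T) :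
  (\forall y \near x, f y = g y) ->
  {for x, continuous f} -> {for x, continuous g}.
Proof.
move=> fg cf; rewrite /prop_for /continuous_at -(nbhs_singleton fg).
by apply: cvg_trans cf; apply: near_eq_cvg.
Qed.

Section Differentials.
Context {R : realType} {V W : normedModType R}.
Implicit Types (f g : V -> W) (x : V).

Lemma diff_epsP f x (df : {linear V -> W}) : continuous df ->
  (forall e : R, 0 < e ->
    \forall h \near (0 : V), `|f (h + x) - f x - df h| <= e * `|h|) <->
  differentiable f x /\ 'd f x = df :> (V -> W).
Proof.
move=> cdf; split=> [H|[/diff_locally /eqaddoP dfx dfE] e e0].
  have fE : f \o shift x = cst (f x) + df +o_ 0 id.
    apply/eqaddoP => e e0; near=> h.
    by rewrite !fctE /= opprD addrA; near: h; exact: H.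
  have dE := diff_unique cdf fE.
  by split=> //; apply/diff_locallyP; rewrite dE.
near=> h.
have -> : f (h + x) - f x - df h
    = (f \o shift x - (cst (f x) + 'd f x)) h by rewrite !fctE /= dfE opprD addrA.
by near: h; exact: dfx.
Unshelve. all: by end_near. Qed.

(** Chart expressions of composites agree with the intended maps only near the base point, so
    differentials have to be carried along equality of germs. *)
Lemma near_eq_diff f g x : (\forall y \near x, f y = g y) ->
  differentiable f x -> differentiable g x /\ 'd g x = 'd f x :> (V -> W).
Proof.
move=> fg df; have cdf := diff_continuous df.
apply/(diff_epsP _ _ cdf) => e e0.
have /(_ e e0) H := (iffRL (diff_epsP f x cdf)) (conj df erefl).
have fg0 : \forall h \near (0 : V), f (h + x) = g (h + x).
  have : (fun h => h + x) @ (0 : V) --> x.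
    rewrite -[X in _ --> X]add0r; apply: cvgD; [exact: cvg_id | exact: cvg_cst].
  by move=> /(_ _ fg).
have fgx := nbhs_singleton fg.
near=> h.
have <- : f (h + x) = g (h + x) by near: h.
by rewrite -fgx; near: h.
Unshelve. all: by end_near. Qed.

(* Pointwise version of [Ck_on 1]: it only depends on the germ of [f] at [x]. *)
Definition C1_at f x :=
  (\forall y \near x, differentiable f y) /\
  forall v, {for x, continuous (fun y => 'd f y v)}.

Lemma Ck_on1P (U : set V) f : open U ->
  Ck_on 1 U f <-> forall x, U x -> C1_at f x.
Proof.
move=> oU; split=> [[df cdf] x Ux|H].
  split=> [|v]; last exact: cdf.
  by near=> y; apply: df; near: y; exact: open_nbhs_nbhs.
split=> [x Ux|v x Ux]; have [dfx cdfx] := H _ Ux; last exact: cdfx.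
exact: nbhs_singleton dfx.
Unshelve. all: by end_near. Qed.

Lemma C1_at_diff f x : C1_at f x -> differentiable f x.
Proof. by case=> /nbhs_singleton. Qed.

Lemma C1_at_continuous f x : C1_at f x -> {for x, continuous f}.
Proof. by move=> /C1_at_diff; exact: differentiable_continuous. Qed.

Lemma near_eq_C1_at f g x : (\forall y \near x, f y = g y) ->
  C1_at f x -> C1_at g x.
Proof.
move=> fg [df cdf].
have dfg : \forall y \near x, differentiable f y /\ differentiable g y /\
    'd g y = 'd f y :> (V -> W).
  (* Comparing the differentials at a nearby [y] takes equality on a neighbourhood of [y], not just
     at [y]. *)
  move: fg => /near_join fg.
  near=> y; have dfy : differentiable f y by near: y.
  by split=> //; apply: near_eq_diff dfy; near: y.
split=> [|v]; first by apply: filterS dfg => y [_ []].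
by apply: near_eq_continuous (cdf v); apply: filterS dfg => y [_ [_ /= ->]].
Unshelve. all: by end_near. Qed.

End Differentials.

(** * Finite-dimensional calculus on column vectors, coordinate by coordinate *)

Section Columns.
Context {R : realType}.

Lemma col_sum_delta p (v : 'cV[R]_p) : v = \sum_j v j 0 *: delta_mx j 0.
Proof.
by rewrite [LHS]matrix_sum_delta; apply: eq_bigr => j _; rewrite big_ord1.
Qed.

Lemma linear_col (W : lmodType R) p (l : {linear 'cV[R]_p -> W}) v :
  l v = \sum_j v j 0 *: l (delta_mx j 0).
Proof.
by rewrite {1}[v]col_sum_delta linear_sum; apply: eq_bigr => j _; rewrite linearZ.
Qed.

Lemma cvg_sum_fin (T : Type) (F : set_system T) {FF : Filter F}
    (W : normedModType R) (I : finType) (f : I -> T -> W) (l : I -> W) :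
  (forall i, f i x @[x --> F] --> l i) ->
  \sum_i f i x @[x --> F] --> \sum_i l i.
Proof.
by move=> fl; apply: cvg_big => [|i _]; [exact: add_continuous | exact: fl].
Qed.

Lemma linear_col_continuous (W : normedModType R) p
  (l : {linear 'cV[R]_p -> W}) : continuous l.
Proof.
move=> v; apply: (@near_eq_continuous _ _
  (fun w : 'cV[R]_p => \sum_j w j 0 *: l (delta_mx j 0))).
  by near=> w; rewrite -linear_col.
by apply: (cvg_sum_fin (F := nbhs v)) => j; apply: cvgZr_tmp; exact: coord_continuous.
Unshelve. all: by end_near. Qed.

Lemma cvg_col (T : Type) (F : set_system T) {FF : Filter F} p
    (f : T -> 'cV[R]_p) (l : 'cV[R]_p) :
  (forall i, f x i 0 @[x --> F] --> l i 0) -> f x @[x --> F] --> l.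
Proof.
move=> fl; rewrite [l]col_sum_delta.
have -> : f = fun x => \sum_j f x j 0 *: delta_mx j 0.
  by apply/funext => x; exact: col_sum_delta.
by apply: cvg_sum_fin => j; apply: cvgZr_tmp; exact: fl.
Qed.

Lemma differentiable_col (V : normedModType R) p (f : V -> 'cV[R]_p) x :
  (forall i, differentiable (fun y => f y i 0) x) -> differentiable f x.
Proof.
move=> df.
have -> : f = \sum_j (fun y => f y j 0 *: delta_mx j 0).
  by apply/funext => y; rewrite fct_sumE; exact: col_sum_delta.
by apply: differentiable_sum => j; exact: differentiableZl.
Qed.

Lemma diff_col (V : normedModType R) p (f : V -> 'cV[R]_p) x v i :
  differentiable f x -> 'd (fun y => f y i 0) x v = 'd f x v i 0.
Proof.
move=> df; pose l (N : 'cV[R]_p) : R := N i 0.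
have ll : linear l by move=> a u w; rewrite /l !mxE.
pose L : {linear 'cV[R]_p -> R} := HB.pack l (GRing.isLinear.Build _ _ _ _ l ll).
rewrite (_ : (fun y => f y i 0) = (L : _ -> _) \o f)//.
rewrite diff_comp//; last by apply: linear_differentiable; exact: linear_col_continuous.
exact: (congr1 (@^~ ('d f x v)) (diff_lin (f x) (@linear_col_continuous _ _ L))).
Qed.

Lemma differentiable_coordl (V : normedModType R) p (f : V -> 'cV[R]_p) x i :
  differentiable f x -> differentiable (fun y => f y i 0) x.
Proof.
move=> df; apply: (differentiable_comp df (differentiable_coord _ i 0)).
Qed.

Lemma C1_at_col (V : normedModType R) p (f : V -> 'cV[R]_p) x :
  (forall i, C1_at (fun y => f y i 0) x) <-> C1_at f x.
Proof.
split=> [H|[df cdf] i].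
  have df : \forall y \near x, differentiable f y.
    have : \forall y \near x, forall i, differentiable (fun y => f y i 0) y.
      by apply: filter_forall => i; have [] := H i.
    by apply: filterS => y; exact: differentiable_col.
  split=> // v; apply: (cvg_col (F := nbhs x)) => i; have [_ /(_ v)] := H i.
  rewrite /prop_for /continuous_at/= (diff_col _ _ (nbhs_singleton df)).
  apply: cvg_trans; apply: near_eq_cvg.
  by apply: filterS df => y dfy; rewrite diff_col.
split=> [|v]; first by apply: filterS df => y; exact: differentiable_coordl.
have dfx := nbhs_singleton df.
apply: near_eq_continuous (_ : {for x, continuous (fun y => 'd f y v i 0)}).
  by apply: filterS df => y dfy /=; rewrite diff_col.
by apply: (@continuous_comp _ _ _ (fun y => 'd f y v) (fun M : 'cV[R]_p => M i 0));
  [exact: cdf | exact: coord_continuous].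
Qed.

Lemma diff_compE (U V W : normedModType R) (f : U -> V) (g : V -> W) x v :
  differentiable f x -> differentiable g (f x) ->
  'd (g \o f) x v = 'd g (f x) ('d f x v).
Proof. by move=> df dg; rewrite diff_comp. Qed.

(** In ['d g (f y) ('d f y v)] both the base point and the direction move with [y], while [C1_at g]
    gives continuity for a fixed direction only. Expanding the direction in the standard basis of
    the middle space separates the two. *)
Lemma C1_at_comp (V W : normedModType R) p (f : V -> 'cV[R]_p) (g : 'cV[R]_p -> W) x :
  C1_at f x -> C1_at g (f x) -> C1_at (g \o f) x.
Proof.
move=> C1f [dg cdg]; have [df cdf] := C1f; have cf := C1_at_continuous C1f.
have dgf : \forall y \near x, differentiable f y /\ differentiable g (f y).
  exact: filterI df (cf _ dg).
split=> [|v]; first by apply: filterS dgf => y [? ?]; exact: differentiable_comp.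
apply: near_eq_continuous (_ : {for x, continuous
  (fun y => \sum_j 'd f y v j 0 *: 'd g (f y) (delta_mx j 0))}).
  apply: filterS dgf => y [? ?] /=; rewrite (@diff_compE _ _ _ f g)//.
  exact/esym/linear_col.
apply: (cvg_sum_fin (F := nbhs x)) => j; apply: cvgZ.
  by apply: (@continuous_comp _ _ _ (fun y => 'd f y v) (fun M : 'cV[R]_p => M j 0));
    [exact: cdf | exact: coord_continuous].
by apply: (@continuous_comp _ _ _ f (fun z => 'd g z (delta_mx j 0))) => //; exact: cdg.
Unshelve. all: by end_near. Qed.

Lemma C1_at_cst (V W : normedModType R) (a : W) (x : V) : C1_at (fun=> a) x.
Proof.
split=> [|v]; first by near=> y; exact: differentiable_cst.
have -> : (fun y : V => 'd (fun=> a) y v) = fun=> 0.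
  by apply/funext => y; rewrite diff_cst.
exact: cst_continuous.
Unshelve. all: by end_near. Qed.

Lemma C1_at_add (V W : normedModType R) (f g : V -> W) x :
  C1_at f x -> C1_at g x -> C1_at (fun y => f y + g y) x.
Proof.
move=> [df cdf] [dg cdg].
have dfg : \forall y \near x, differentiable f y /\ differentiable g y.
  by near=> y; split; near: y.
split=> [|v]; first by apply: filterS dfg => y [? ?]; exact: differentiableD.
apply: near_eq_continuous (_ : {for x, continuous (fun y => 'd f y v + 'd g y v)}).
  apply: filterS dfg => y [? ?] /=.
  by rewrite (_ : (fun y => f y + g y) = f + g)// diffD.
by apply: cvgD; [exact: cdf | exact: cdg].
Unshelve. all: by end_near. Qed.

Lemma C1_at_scalel (V W : normedModType R) (f : V -> R) (w : W) x :
  C1_at f x -> C1_at (fun y => f y *: w) x.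
Proof.
move=> [df cdf].
split=> [|v]; first by apply: filterS df => y; exact: differentiableZl.
apply: near_eq_continuous (_ : {for x, continuous (fun y => 'd f y v *: w)}).
  by apply: filterS df => y ? /=; rewrite diffZl.
by apply: cvgZr_tmp; exact: cdf.
Qed.

Lemma C1_at_linear p (W : normedModType R) (l : {linear 'cV[R]_p -> W}) x :
  C1_at l x.
Proof.
split=> [|v].
  by near=> y; apply: linear_differentiable; exact: linear_col_continuous.
have -> : (fun y => 'd l y v) = fun=> l v.
  by apply/funext => y; rewrite diff_lin//; exact: linear_col_continuous.
exact: cst_continuous.
Unshelve. all: by end_near. Qed.

End Columns.

(** * Uniform limits of derivatives *)

Section UniformLimit.
Context {R : realType}.

Lemma is_derive_segment (V : normedModType R) (g : V -> R) (y h : V) (t : R) :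
  differentiable g (t *: h + y) ->
  is_derive t 1 (fun s : R => g (s *: h + y)) ('d g (t *: h + y) h).
Proof.
move=> dg; pose p (s : R) := s *: h + y.
have dp : is_diff t p ( *:%R^~ h).
  by apply: is_diff_eq; rewrite addr0.
have dgp : differentiable (g \o p) t by exact: differentiable_comp.
apply: DeriveDef; first exact/derivable1_diffP.
rewrite deriveE// (@diff_compE _ _ _ _ p g)//.
by have -> : 'd p t 1 = h by rewrite diff_val scale1r.
Qed.

(** Mean value theorem on the segment from [y] to [h + y], which stays in the ball by convexity; [b]
    bounds the derivative along [h] itself. *)
Lemma diff_increment_le (V : normedModType R) (g : V -> R) (x y h : V) (r b : R) :
  (forall z, ball x r z -> differentiable g z /\ `|'d g z h| <= b) ->
  ball x r y -> ball x r (h + y) -> `|g (h + y) - g y| <= b.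
Proof.
move=> dg xy xhy.
have seg (t : R) : 0 <= t <= 1 -> ball x r (t *: h + y).
  move=> /andP[t0 t1]; move: xy xhy; rewrite -!ball_normE /= => xy xhy.
  have -> : x - (t *: h + y) = (1 - t) *: (x - y) + t *: (x - (h + y)).
    have sub2 (k : V) : x - (k + y) = x - y - k by rewrite opprD addrA addrAC.
    rewrite !sub2; move: (x - y) => w.
    by rewrite scalerBl scale1r scalerBr addrA subrK.
  apply: le_lt_trans (ler_normD _ _) _; rewrite !normrZ !ger0_norm ?subr_ge0//.
  (* The strict inequality comes from the term weighted by [t], so [t = 0] is treated apart. *)
  have [->|tn0] := eqVneq t 0; first by rewrite subr0 mul1r mul0r addr0.
  have {}t0 : 0 < t by rewrite lt_def tn0.
  have -> : r = (1 - t) * r + t * r by ring.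
  by apply: ler_ltD; [rewrite ler_wpM2l ?subr_ge0// ltW | rewrite ltr_pM2l].
have dseg (s : R) : 0 <= s <= 1 ->
    is_derive s 1 (fun s : R => g (s *: h + y)) ('d g (s *: h + y) h).
  by move=> s01; apply: is_derive_segment; have [] := dg _ (seg s s01).
have [||c c01] := @MVT_segment R (fun s => g (s *: h + y))
    (fun s => 'd g (s *: h + y) h) 0 1 ler01.
- by move=> s; rewrite in_itv/= => /andP[s0 s1]; apply: dseg; rewrite !ltW.
- apply: derivable_within_continuous => s; rewrite in_itv/= => s01.
  by have [] := dseg s s01.
rewrite scale1r scale0r add0r subr0 mulr1 => ->.
by have [|_] := dg (c *: h + y) (seg c _).
Qed.

(** * Differentiating a pointwise limit whose differentials are uniformly Cauchy on a ball *)

Section Limit.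
Context {V : normedModType R}.
Variables (u_ : nat -> V -> R) (u : V -> R) (x : V) (r : R).
Hypothesis r_gt0 : 0 < r.
Hypothesis linear_continuous : forall l : {linear V -> R}, continuous l.
Hypothesis u_C1 : forall k y, ball x r y -> C1_at (u_ k) y.
Hypothesis u_cvg : forall y, ball x r y -> u_ k y @[k --> \oo] --> u y.
Hypothesis du_cauchy : forall e, 0 < e -> exists N, forall k l,
  (N <= k)%N -> (N <= l)%N -> forall y v, ball x r y ->
  `|'d (u_ k) y v - 'd (u_ l) y v| <= e * `|v|.

Let du y v : R := limn (fun k => 'd (u_ k) y v).

Let cvg_du y v : ball x r y -> 'd (u_ k) y v @[k --> \oo] --> du y v.
Proof.
move=> xy; apply/cauchy_cvgP/cauchy_exP => e e0.
(* Adding 1 keeps the divisor positive when [v = 0] and makes the final inequality strict. *)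
have v1 : 0 < `|v| + 1 by rewrite ltr_wpDl.
have [N HN] := du_cauchy (divr_gt0 e0 v1).
exists ('d (u_ N) y v); exists N => // k /= Nk.
rewrite -ball_normE /=; apply: le_lt_trans (HN _ _ (leqnn N) Nk y v xy) _.
by rewrite -mulrA gtr_pMr// mulrC ltr_pdivrMr// mul1r ltrDl.
Qed.

Let du_unif e : 0 < e -> exists N, forall k, (N <= k)%N ->
  forall y v, ball x r y -> `|'d (u_ k) y v - du y v| <= e * `|v|.
Proof.
move=> /du_cauchy [N HN]; exists N => k Nk y v xy.
have cl : `|'d (u_ k) y v - 'd (u_ l) y v| @[l --> \oo] --> `|'d (u_ k) y v - du y v|.
  by apply: cvg_norm; apply: cvgB; [exact: cvg_cst | exact: cvg_du].
rewrite -(cvg_lim (@Rhausdorff R) cl); apply: limr_le.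
  by apply/cvg_ex; exists (`|'d (u_ k) y v - du y v|).
by exists N => // l /= Nl; exact: HN.
Qed.

(** This is the exchange of limits. The mean value inequality for [u_ k - u_ l] bounds the
    difference of increments by [e * |h|], uniformly in [l]; letting [l] tend to infinity replaces
    [u_ l] by [u]. *)
Let increment_unif e : 0 < e -> exists N, forall k, (N <= k)%N ->
  forall y h, ball x r y -> ball x r (h + y) ->
  `|(u_ k (h + y) - u_ k y) - (u (h + y) - u y)| <= e * `|h|.
Proof.
move=> /du_cauchy [N HN]; exists N => k Nk y h xy xhy.
have cl : `|(u_ k (h + y) - u_ k y) - (u_ l (h + y) - u_ l y)| @[l --> \oo] -->
    `|(u_ k (h + y) - u_ k y) - (u (h + y) - u y)|.
  apply: cvg_norm; apply: cvgB; first exact: cvg_cst.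
  by apply: cvgB; exact: u_cvg.
rewrite -(cvg_lim (@Rhausdorff R) cl); apply: limr_le.
  by apply/cvg_ex; exists (`|(u_ k (h + y) - u_ k y) - (u (h + y) - u y)|).
exists N => // l /= Nl.
have -> : (u_ k (h + y) - u_ k y) - (u_ l (h + y) - u_ l y) =
    (u_ k - u_ l) (h + y) - (u_ k - u_ l) y by rewrite !fctE; ring.
apply: (@diff_increment_le _ _ x y h r) => // z xz.
have dk := C1_at_diff (u_C1 k xz); have dl := C1_at_diff (u_C1 l xz).
split; first exact: differentiableB.
by rewrite diffB//; exact: HN.
Qed.

Let diff_u y : ball x r y -> differentiable u y /\ 'd u y = du y :> (V -> R).
Proof.
move=> xy.
have ldu : linear (du y).
  move=> a v w; apply: (cvg_lim (@Rhausdorff R)).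
  have -> : (fun k => 'd (u_ k) y (a *: v + w)) =
      fun k => a *: 'd (u_ k) y v + 'd (u_ k) y w.
    by apply/funext => k; rewrite linearP.
  by apply: cvgD; [apply: cvgZl_tmp; exact: cvg_du | exact: cvg_du].
pose l : {linear V -> R} := HB.pack (du y) (GRing.isLinear.Build _ _ _ _ (du y) ldu).
apply/(@diff_epsP _ _ _ u y l); first exact: linear_continuous.
(* Three errors of [e / 3]: [du] against ['d (u_ k)], increments of [u] against those of [u_ k], and
   the differentiability of the single function [u_ k]. *)
move=> e e0; have e3 : 0 < e / 3 by rewrite divr_gt0.
have [N1 HN1] := du_unif e3; have [N2 HN2] := increment_unif e3.
pose k := maxn N1 N2.
have dk := C1_at_diff (u_C1 k xy).
have /(_ _ e3) Hd := (iffRL (diff_epsP (u_ k) y (diff_continuous dk))) (conj dk erefl).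
have near_ball : \forall h \near (0 : V), ball x r (h + y).
  have : (fun h => h + y) @ (0 : V) --> y.
    by rewrite -[X in _ --> X]add0r; apply: cvgD; [exact: cvg_id | exact: cvg_cst].
  by apply; apply: open_nbhs_nbhs; split=> //; exact: ball_open.
near=> h.
have xhy : ball x r (h + y) by near: h.
have dh : `|u_ k (h + y) - u_ k y - 'd (u_ k) y h| <= e / 3 * `|h| by near: h.
have := HN1 k (leq_maxl _ _) y h xy.
have := HN2 k (leq_maxr _ _) y h xy xhy.
rewrite [in X in _ -> _ -> X]/=.
move: dh; rewrite !ler_norml => /andP[? ?] /andP[? ?] /andP[? ?].
by apply/andP; split; lra.
Unshelve. all: by end_near. Qed.

Lemma C1_at_lim : C1_at u x /\
  forall v, 'd (u_ k) x v @[k --> \oo] --> 'd u x v.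
Proof.
have xx : ball x r x by exact: ballxx.
have near_x : \forall y \near x, ball x r y by exact: nbhsx_ballx.
have [dux duxE] := diff_u xx.
split=> [|v]; last by rewrite duxE; exact: cvg_du.
split=> [|v]; first by apply: filterS near_x => y /diff_u[].
apply/cvgrPdist_le => e e0.
have v1 : 0 < `|v| + 1 by rewrite ltr_wpDl.
have e3 : 0 < e / 3 by rewrite divr_gt0.
have [N HN] := du_unif (divr_gt0 e3 v1).
have bnd y : ball x r y -> `|'d (u_ N) y v - du y v| <= e / 3.
  move=> xy; apply: le_trans (HN _ (leqnn N) y v xy) _.
  by rewrite -mulrA ger_pMr// mulrC ler_pdivrMr// mul1r lerDl.
have [_ /(_ v) /cvgrPdist_le /(_ _ e3) Hc] := u_C1 N xx.
near=> y.
have xy : ball x r y by near: y.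
have [_ duyE] := diff_u xy.
have c3 : `|'d (u_ N) x v - 'd (u_ N) y v| <= e / 3 by near: y.
have := bnd _ xx; have := bnd _ xy.
rewrite duyE duxE; move: c3; rewrite !ler_norml => /andP[? ?] /andP[? ?] /andP[? ?].
by apply/andP; split; lra.
Unshelve. all: by end_near. Qed.

End Limit.
End UniformLimit.

(** * Euclidean norm and activation functions *)

Section EuclideanNorm.
Context {R : realType} {k : nat}.
Implicit Types v w : 'cV[R]_k.

Lemma enorm_ge0 v : 0 <= enorm v.
Proof. exact: sqrtr_ge0. Qed.

Lemma sqr_enorm v : enorm v ^+ 2 = \sum_i v i 0 ^+ 2.
Proof. by rewrite sqr_sqrtr// sumr_ge0// => i _; exact: sqr_ge0. Qed.

Lemma enorm_le_sqr v (b : R) : 0 <= b -> (enorm v <= b) = (\sum_i v i 0 ^+ 2 <= b ^+ 2).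
Proof.
by move=> b0; rewrite -sqr_enorm ler_pXn2r// ?nnegrE// enorm_ge0.
Qed.

Lemma coord_le_enorm v i : `|v i 0| <= enorm v.
Proof.
rewrite /enorm -sqrtr_sqr ler_wsqrtr// (bigD1 i)//= lerDl.
by rewrite sumr_ge0// => j _; exact: sqr_ge0.
Qed.

Lemma enorm0_eq0 v : enorm v = 0 -> forall i, v i 0 = 0.
Proof.
by move=> v0 i; apply/eqP; rewrite -normr_le0 -v0; exact: coord_le_enorm.
Qed.

Lemma cauchy_schwarz v w : \sum_i v i 0 * w i 0 <= enorm v * enorm w.
Proof.
have [v0|vn0] := eqVneq (enorm v) 0.
  by rewrite v0 mul0r big1// => i _; rewrite (enorm0_eq0 v0) mul0r.
have [w0|wn0] := eqVneq (enorm w) 0.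
  by rewrite w0 mulr0 big1// => i _; rewrite (enorm0_eq0 w0) mulr0.
have vw0 : 0 < enorm v * enorm w by rewrite mulr_gt0// lt_def ?vn0 ?wn0 enorm_ge0.
(* After this scaling, sum [2 s t <= s^2 + t^2] with [s = enorm w * v i 0] and
   [t = enorm v * w i 0]: the right side totals [2 (enorm v * enorm w)^2]. *)
rewrite -(ler_pM2l vw0).
have : \sum_i 2 * (enorm v * enorm w) * (v i 0 * w i 0) <=
    \sum_i ((enorm w * v i 0) ^+ 2 + (enorm v * w i 0) ^+ 2).
  by apply: ler_sum => i _; have := sqr_ge0 (enorm w * v i 0 - enorm v * w i 0); nra.
rewrite -mulr_sumr big_split/= !(eq_bigr _ (fun i _ => exprMn _ _ _)) -!mulr_sumr.
by rewrite -!sqr_enorm; nra.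
Qed.

Lemma ler_enormD v w : enorm (v + w) <= enorm v + enorm w.
Proof.
rewrite enorm_le_sqr ?addr_ge0 ?enorm_ge0//.
have -> : \sum_i (v + w) i 0 ^+ 2 =
    enorm v ^+ 2 + enorm w ^+ 2 + 2 * \sum_i v i 0 * w i 0.
  rewrite !sqr_enorm mulr_sumr -!big_split/=; apply: eq_bigr => i _.
  by rewrite mxE; ring.
by have := cauchy_schwarz v w; nra.
Qed.

Lemma enormZ (a : R) v : enorm (a *: v) = `|a| * enorm v.
Proof.
rewrite /enorm -sqrtr_sqr -sqrtrM ?sqr_ge0//; congr Num.sqrt.
by rewrite mulr_sumr; apply: eq_bigr => i _; rewrite mxE exprMn.
Qed.

Lemma enormN v : enorm (- v) = enorm v.
Proof. by rewrite -scaleN1r enormZ normrN1 mul1r. Qed.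

Lemma enorm0 : enorm (0 : 'cV[R]_k) = 0.
Proof. by rewrite -(scale0r 0) enormZ normr0 mul0r. Qed.

Lemma coord_sub_le_enorm v w i (s t : R) :
  s = v i 0 -> t = w i 0 -> `|s - t| <= enorm (v - w).
Proof. by move=> -> ->; have := coord_le_enorm (v - w) i; rewrite !mxE. Qed.

Lemma ler_enorm v w : (forall i, `|v i 0| <= `|w i 0|) -> enorm v <= enorm w.
Proof.
move=> vw; rewrite ler_wsqrtr// ler_sum// => i _.
rewrite -[leLHS]real_normK ?num_real// -[leRHS]real_normK ?num_real//.
by rewrite ler_pXn2r// ?nnegrE.
Qed.

Lemma enorm_le_coord v (e : R) : (forall i, `|v i 0| <= e) -> enorm v <= k%:R * e.
Proof.
move=> ve.
(* No sign of [e] is given: for [k = 0] the product vanishes, otherwise a coordinate forces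
   [0 <= e]. *)
have e0 : 0 <= k%:R * e.
  case: k v ve => [|k'] v ve; first by rewrite mul0r.
  by rewrite mulr_ge0//; exact: le_trans (ve 0).
(* The Euclidean norm is at most the sum of the absolute values. The resulting factor [k] is crude
   but enough for boundedness. *)
have sum_le (s : seq 'I_k) : \sum_(i <- s) v i 0 ^+ 2 <= (\sum_(i <- s) `|v i 0|) ^+ 2.
  elim: s => [|i s IH]; first by rewrite !big_nil expr0n.
  rewrite !big_cons; have := normr_ge0 (v i 0).
  have : 0 <= \sum_(j <- s) `|v j 0| by rewrite sumr_ge0.
  by rewrite -[v i 0 ^+ 2]real_normK ?num_real//; nra.
rewrite enorm_le_sqr//; apply: le_trans (sum_le _) _.
rewrite ler_pXn2r// ?nnegrE ?sumr_ge0//.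
by apply: le_trans (ler_sum _ (fun i _ => ve i)) _; rewrite sumr_const card_ord mulr_natl.
Qed.

Lemma coord_le_norm v i : `|v i 0| <= `|v|.
Proof.
rewrite [leRHS]mx_normrE; apply/bigmax_geP; right => /=.
by exists (i, 0).
Qed.

End EuclideanNorm.

Section Activation.
Context {R : realType}.
Variables (sigma : R -> R) (sigmaP : activation sigma).

Lemma activation_is_derive (t : R) : is_derive t 1 sigma (derive1 sigma t).
Proof.
case: sigmaP => ds _ _ _; apply: DeriveDef; first exact: ds.
by rewrite derive1E.
Qed.

Lemma activation_lipschitz (s t : R) : `|sigma s - sigma t| <= `|s - t|.
Proof.
wlog st : s t / t <= s.
  by move=> H; case: (leP t s) => [/H//|/ltW /H]; rewrite distrC [leRHS]distrC.
have [c _ ->] := MVT_segment st (fun c _ => activation_is_derive c)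
  (derivable_within_continuous (fun c _ => @ex_derive _ _ _ _ _ _ _ (activation_is_derive c))).
case: sigmaP => _ _ _ /(_ c) /andP[c0 c1].
by rewrite normrM ler_piMl// ger0_norm ltW.
Qed.

(** Heine-Cantor on [[-b, b]], with only [s] confined to the segment. A radius that serves near each
    point becomes a common [d] by compactness, in its near-covering form. *)
Lemma activation_derive_unif (b e : R) : 0 < e -> exists2 d, 0 < d &
  forall s t, `|s| <= b -> `|s - t| <= d -> `|derive1 sigma s - derive1 sigma t| <= e.
Proof.
move=> e0; have e2 : 0 < e / 2 by rewrite divr_gt0.
have cs : continuous (derive1 sigma) by case: sigmaP.
have K : compact `[(- b), b]%classic by exact: segment_compact.
have : \forall d \near (0 : R)^'+, `[(- b), b]%classic `<=`
    (fun s => forall t, `|s - t| <= d -> `|derive1 sigma s - derive1 sigma t| <= e).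
  apply: (iffLR (compact_near_coveringP _) K) => s0 _.
  have /cvgrPdist_le /(_ _ e2) /nbhs_ballP[r /= r0 Hr] := cs s0.
  (* Halving the radius keeps [t], within [r / 2] of [s], inside the ball of radius [r] around
     [s0]. *)
  have r2 : 0 < r / 2 by rewrite divr_gt0.
  exists (ball s0 (r / 2), [set d | d < r / 2]).
    by split; [exact: nbhsx_ballx | exact: nbhs_right_lt].
  move=> [s d]/= [s0s dr] t std.
  have h1 : `|derive1 sigma s0 - derive1 sigma s| <= e / 2.
    by apply: Hr; apply: le_ball s0s; lra.
  have h2 : `|derive1 sigma s0 - derive1 sigma t| <= e / 2.
    apply: Hr; rewrite -ball_normE/=; move: s0s; rewrite -ball_normE/= => s0s.
    by rewrite -(subrK s s0) -addrA; apply: le_lt_trans (ler_normD _ _) _; lra.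
  move: h1 h2; rewrite !ler_norml => /andP[? ?] /andP[? ?].
  by apply/andP; split; lra.
move=> Hd; near (0 : R)^'+ => d.
exists d => // s t; rewrite ler_norml => sb.
have : forall s, s \in `[(- b), b] -> forall t, `|s - t| <= d ->
    `|derive1 sigma s - derive1 sigma t| <= e by near: d.
by apply; rewrite in_itv.
Unshelve. all: by end_near. Qed.

End Activation.

(** * Compactness and quadratic forms *)

Section CompactBound.
Context {R : realType} {M : topologicalType}.

(** Monotonicity turns each local constant into a condition that holds for all large [k];
    near-covering at infinity then yields one constant for the whole space. *)
Lemma compact_locally_bounded (P : R -> M -> Prop) :
  compact [set: M] -> (forall k k' x, k <= k' -> P k x -> P k' x) ->
  (forall x : M, exists k, \forall x' \near x, P k x') ->
  exists2 k, 0 <= k & forall x, P k x.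
Proof.
move=> cM Pmon Ploc.
have : \forall k \near +oo, [set: M] `<=` P k.
  apply: (iffLR (compact_near_coveringP _) cM) => x _.
  have [k Pk] := Ploc x.
  exists (P k, [set k' | k <= k']).
    by split=> //=; apply: nbhs_pinfty_ge; exact: num_real.
  by move=> [x' k']/= [Px' kk']; exact: Pmon Px'.
move=> H; near (pinfty_nbhs R) => k; exists k.
  by near: k; apply: nbhs_pinfty_ge; exact: num_real.
have : [set: M] `<=` P k by near: k.
by move=> Pk x; exact: Pk.
Unshelve. all: by end_near. Qed.

End CompactBound.

Section QuadraticForm.
Context {R : realType}.

Lemma quad_formE p (G : 'M[R]_p) (v : 'cV[R]_p) :
  (v^T *m G *m v) 0 0 = \sum_j (\sum_i v i 0 * G i j) * v j 0.
Proof.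
rewrite mxE; apply: eq_bigr => j _; congr (_ * _).
by rewrite mxE; apply: eq_bigr => i _; rewrite mxE.
Qed.

Lemma quad_formZ p (G : 'M[R]_p) (a : R) (v : 'cV[R]_p) :
  ((a *: v)^T *m G *m (a *: v)) 0 0 = a ^+ 2 * (v^T *m G *m v) 0 0.
Proof.
rewrite !quad_formE mulr_sumr; apply: eq_bigr => j _.
have -> : \sum_i (a *: v) i 0 * G i j = a * \sum_i v i 0 * G i j.
  by rewrite mulr_sumr; apply: eq_bigr => i _; rewrite mxE mulrA.
by rewrite mxE; ring.
Qed.

Lemma compact_sphere p : compact [set v : 'cV[R]_p | `|v| = 1].
Proof.
(* Transposition moves the sphere to row vectors, where [bounded_closed_compact] applies. *)
pose T (w : 'rV[R]_p) : 'cV[R]_p := w^T.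
have cT : continuous T.
  move=> w; apply: (cvg_col (F := nbhs w)) => i; rewrite /T mxE.
  under eq_fun do rewrite mxE.
  exact: coord_continuous.
have -> : [set v : 'cV[R]_p | `|v| = 1] = T @` (T @^-1` [set v | `|v| = 1]).
  rewrite eqEsubset; split=> [v v1|_ [w w1 <-]//].
  by exists v^T; rewrite /T/= trmxK.
apply: continuous_compact; first exact: continuous_subspaceT.
apply: bounded_closed_compact.
  exists 1; split=> // k k1 w /= w1; apply: le_trans (ltW k1); rewrite -w1.
  rewrite [leLHS]mx_normrE; apply: bigmax_le => // -[i j] _ /=.
  by rewrite (ord1 i); have := coord_le_norm (T w) j; rewrite mxE.
apply: closed_comp => [w _|]; first exact: cT.
apply: (@closed_comp _ _ (fun v : 'cV[R]_p => `|v|) [set 1]) => [v _|].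
  exact: norm_continuous.
exact: closed_eq.
Qed.

Section ContinuousFamily.
Variables (T : topologicalType) (p : nat) (G : T -> 'M[R]_p) (y0 : T).
Hypothesis cG : {for y0, continuous G}.

Lemma quad_form_cvg (v0 : 'cV[R]_p) :
  (fun z : 'cV[R]_p * T => (z.1^T *m G z.2 *m z.1) 0 0) @ (v0, y0) -->
  (v0^T *m G y0 *m v0) 0 0.
Proof.
rewrite quad_formE; under eq_cvg do rewrite quad_formE.
have c1 (i : 'I_p) : (fun z : 'cV[R]_p * T => z.1 i 0) @ (v0, y0) --> v0 i 0.
  apply: (@cvg_comp _ _ _ fst (fun v : 'cV[R]_p => v i 0) _ (nbhs v0)).
    exact: cvg_fst.
  exact: coord_continuous.
apply: (cvg_sum_fin (F := nbhs (v0, y0))) => j; apply: cvgM; last exact: c1.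
apply: (cvg_sum_fin (F := nbhs (v0, y0))) => i; apply: cvgM; first exact: c1.
apply: (@cvg_comp _ _ _ snd (fun y => G y i j) _ (nbhs y0)); first exact: cvg_snd.
exact: (@continuous_comp _ _ _ G (fun N : 'M[R]_p => N i j) y0 cG
  (@coord_continuous _ _ _ i j _)).
Qed.

(** The form is jointly continuous in the vector and the base point and positive on the unit sphere
    over [y0]. Compactness of the sphere gives one lower bound [d] there for all [y] near [y0], and
    homogeneity extends it to all vectors. The constant obtained is [Num.sqrt d], since the form is
    quadratic. *)
Lemma posdef_lower_bound :
  (forall v : 'cV[R]_p, v != 0 -> 0 < (v^T *m G y0 *m v) 0 0) ->
  exists2 d : R, 0 < d & \forall y \near y0, forall v : 'cV[R]_p,
    (d * `|v|) ^+ 2 <= (v^T *m G y *m v) 0 0.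
Proof.
move=> pos.
(* The lower bound and the base point form a single parameter [z], so that one covering argument
   handles both. *)
have : \forall z \near filter_prod (0 : R)^'+ (nbhs y0),
    [set v : 'cV[R]_p | `|v| = 1] `<=` (fun v => z.1 <= (v^T *m G z.2 *m v) 0 0).
  apply: (iffLR (compact_near_coveringP _) (@compact_sphere p)) => v0 v01.
  have : 0 < (v0^T *m G y0 *m v0) 0 0.
    by apply: pos; rewrite -normr_gt0 v01.
  set q0 := (v0^T *m _ *m _) _ _ => q0_gt0.
  have q2 : q0 / 2 < q0 by lra.
  have := cvgr_gt q0 (@quad_form_cvg v0) _ q2; case=> -[A B] /= [nA nB] AB.
  exists (A, [set z | z.1 < q0 / 2 /\ B z.2]).
    split=> //; exists ([set d | d < q0 / 2], B) => //.
    by split=> //; apply: nbhs_right_lt; rewrite divr_gt0.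
  move=> [v [d y]] /= [Av [dq By]]; rewrite ltW//.
  by apply: lt_trans dq _; exact: (AB (v, y)).
case=> -[A B] /= [nA nB] AB.
near (0 : R)^'+ => d.
have d0 : 0 < d by [].
have Ad : A d by near: d.
exists (Num.sqrt d); first by rewrite sqrtr_gt0.
apply: filterS nB => y By v.
rewrite exprMn sqr_sqrtr; last exact: ltW.
have [->|v0] := eqVneq v 0.
  by rewrite normr0 expr0n/= mulr0 mulmx0 mxE.
have nv0 : `|v| != 0 by rewrite normr_eq0.
have w1 : `| `|v|^-1 *: v | = 1 by rewrite normrZ normfV normr_id mulVf.
have := AB (d, y) (conj Ad By) _ w1 => /=.
by rewrite quad_formZ exprVn mulrC ler_pdivlMr// exprn_gt0// normr_gt0.
Unshelve. all: by end_near. Qed.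

Lemma quad_form_upper_bound :
  exists k : R, \forall y \near y0, forall v : 'cV[R]_p,
    (v^T *m G y *m v) 0 0 <= k * `|v| ^+ 2.
Proof.
exists (\sum_j \sum_i (`|G y0 i j| + 1)).
have Hij : \forall y \near y0, forall j i, `|G y i j| <= `|G y0 i j| + 1.
  apply: filter_forall => j; apply: filter_forall => i.
  have c : (fun y => G y i j) @ y0 --> G y0 i j.
    exact: (@continuous_comp _ _ _ G (fun N : 'M[R]_p => N i j) y0 cG
  (@coord_continuous _ _ _ i j _)).
  by have := cvgr_norm_le _ c; apply; rewrite ltrDl.
apply: filterS Hij => y Hy v.
rewrite quad_formE mulr_suml; apply: ler_sum => j _.
rewrite !mulr_suml; apply: ler_sum => i _.
apply: le_trans (ler_norm _) _; rewrite !normrM.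
have := coord_le_norm v i; have := coord_le_norm v j; have := Hy j i.
have := normr_ge0 (v i 0); have := normr_ge0 (v j 0); have := normr_ge0 (G y i j).
move: `|v i 0| `|v j 0| `|G y i j| `|v| => a b c k c0 b0 a0 ck bk ak.
rewrite mulrAC mulrC expr2; apply: ler_pM => //; first by rewrite mulr_ge0.
exact: ler_pM.
Qed.

End ContinuousFamily.
End QuadraticForm.

(** * Derivatives on a Riemannian manifold *)

Section OperatorNorm.
Context {R : realType} {p q : nat}.
Variables (normp : 'cV[R]_p -> R) (normq : 'cV[R]_q -> R).
Hypothesis normp0 : normp 0 = 0.
Hypothesis normpZ : forall a v, normp (a *: v) = `|a| * normp v.
Hypothesis normp_gt0 : forall v, v != 0 -> 0 < normp v.
Hypothesis normq_ge0 : forall v, 0 <= normq v.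
Hypothesis normqZ : forall a v, normq (a *: v) = `|a| * normq v.

Lemma le_opnorm (T : {linear 'cV[R]_p -> 'cV[R]_q}) (k : R) v :
  (opnorm normp normq T <= k%:E)%E -> normq (T v) <= k * normp v.
Proof.
move=> Tk; have [->|v0] := eqVneq v 0.
  by rewrite linear0 normp0 mulr0 -(scale0r 0) normqZ normr0 mul0r.
have nv := normp_gt0 v0.
have : ((normq (T ((normp v)^-1 *: v)))%:E <= k%:E)%E.
  apply: le_trans Tk; apply: ereal_sup_ubound.
  exists ((normp v)^-1 *: v) => //=.
  by rewrite normpZ gtr0_norm ?invr_gt0// mulVf// gt_eqF.
by rewrite lee_fin linearZ/= normqZ gtr0_norm ?invr_gt0// mulrC ler_pdivrMr.
Qed.

Lemma opnorm_le (T : 'cV[R]_p -> 'cV[R]_q) (k : R) : 0 <= k ->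
  (forall v, normq (T v) <= k * normp v) -> (opnorm normp normq T <= k%:E)%E.
Proof.
move=> k0 Tk; apply: ge_ereal_sup => _ [v /= v1 <-].
by rewrite lee_fin (le_trans (Tk v))// ler_piMr.
Qed.

Lemma opnorm_ge0 (T : 'cV[R]_p -> 'cV[R]_q) : (0 <= opnorm normp normq T)%E.
Proof.
apply: (@le_trans _ _ (normq (T 0))%:E); first by rewrite lee_fin.
by apply: ereal_sup_ubound; exists 0 => //=; rewrite normp0 ler01.
Qed.

End OperatorNorm.

Section Nnsup.
Context {R : realType}.

Lemma nnsup_ge0 (X : set (\bar R)) : (0 <= nnsup X)%E.
Proof. by apply: ereal_sup_ubound; left. Qed.

Lemma nnsup_ubound (X : set (\bar R)) y : X y -> (y <= nnsup X)%E.
Proof. by move=> Xy; apply: ereal_sup_ubound; right. Qed.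

Lemma nnsup_le (X : set (\bar R)) (k : \bar R) : (0 <= k)%E ->
  (forall y, X y -> (y <= k)%E) -> (nnsup X <= k)%E.
Proof. by move=> k0 Xk; apply: ge_ereal_sup => y [->//|]; exact: Xk. Qed.

End Nnsup.

Lemma open_nbhs_mem (T : topologicalType) (A : set T) (x : T) :
  open A -> A x -> nbhs x A.
Proof. by move=> oA Ax; exact: open_nbhs_nbhs. Qed.

Section Manifold.
Context {R : realType} {m : nat} {M : topologicalType}.
Variable S : manifold R m M.
Implicit Types (c d : chart R m M) (x : M).

Lemma cmap_cdom c x : cdom c x -> cimg c (cmap c x).
Proof. by move=> cx; exists x. Qed.

Lemma near_cinv c x : cdom c x -> \forall y \near cmap c x,
  cdom c (cinv c y) /\ cmap c (cinv c y) = y.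
Proof.
move=> cx; have : nbhs (cmap c x) (cimg c).
  exact: open_nbhs_mem (@cimg_open _ _ _ c) (cmap_cdom cx).
by apply: filterS => _ [z cz <-]; rewrite cmapK.
Qed.

Lemma cinv_cvg c x : cdom c x -> cinv c @ cmap c x --> x.
Proof.
move=> cx; have := cinv_cont (cmap_cdom cx).
by rewrite /prop_for /continuous_at cmapK.
Qed.

Lemma near_cmap c x (P : 'cV[R]_m -> Prop) : cdom c x ->
  (\forall y \near cmap c x, P y) ->
  \forall z \near x, cdom c z /\ P (cmap c z).
Proof.
move=> cx Px.
exact: filterI (open_nbhs_mem (@cdom_open _ _ _ c) cx) (cmap_cont cx Px).
Qed.

Lemma C1_funP (V : normedModType R) (f : M -> V) :
  C1_fun S f <-> forall c x, atlas S c -> cdom c x ->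
    C1_at (f \o cinv c) (cmap c x).
Proof.
split=> [C1f c x Sc cx|H c Sc].
  by apply: (iffLR (Ck_on1P _ (@cimg_open _ _ _ c)) (C1f c Sc)); exact: cmap_cdom.
by apply/Ck_on1P => [|_ [x cx <-]]; [exact: cimg_open | exact: H].
Qed.

Lemma C1_map_at (phi : M -> M) c d x : C1_map S phi ->
  atlas S c -> atlas S d -> cdom c x -> cdom d (phi x) ->
  C1_at (cmap d \o phi \o cinv c) (cmap c x).
Proof.
move=> [cphi /(_ c d) C1phi] Sc Sd cx dx; have [df cdf] := C1phi Sc Sd.
have Ux : (cmap c @` (cdom c `&` phi @^-1` cdom d)) (cmap c x) by exists x.
split=> [|v]; last exact: cdf.
(* Continuity of [phi] makes the set on which [C1_map] speaks a neighbourhood of [cmap c x]. *)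
have nd : \forall y \near cmap c x, cdom d (phi (cinv c y)).
  have cc : phi \o cinv c @ cmap c x --> phi x.
    exact: cvg_comp (@cinv_cvg c x cx) (cphi x).
  exact: (cc _ (open_nbhs_mem (@cdom_open _ _ _ d) dx)).
near=> y; apply: df.
have [cy yE] : cdom c (cinv c y) /\ cmap c (cinv c y) = y.
  by near: y; exact: near_cinv.
by exists (cinv c y) => //; split=> //=; near: y.
Unshelve. all: by end_near. Qed.

(** Makes changes of charts an instance of [C1_map_at]. *)
Lemma C1_map_id : C1_map S id.
Proof.
by split=> [x|c d Sc Sd]; [exact: cvg_id | exact: (atlas_smooth Sc Sd 1)].
Qed.

Variable g : riemannian_metric S.

Lemma tnorm_ge0 c x v : 0 <= tnorm g c x v.
Proof. exact: sqrtr_ge0. Qed.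

Lemma tnormZ c x (a : R) v : tnorm g c x (a *: v) = `|a| * tnorm g c x v.
Proof. by rewrite /tnorm quad_formZ sqrtrM ?sqr_ge0// sqrtr_sqr. Qed.

Lemma tnorm0 c x : tnorm g c x 0 = 0.
Proof. by rewrite -(scale0r 0) tnormZ normr0 mul0r. Qed.

Lemma tnorm_gt0 c x v : atlas S c -> cdom c x -> v != 0 -> 0 < tnorm g c x v.
Proof. by move=> Sc cx v0; rewrite sqrtr_gt0; exact: gram_posdef. Qed.

Lemma gram_continuous c x : atlas S c -> cdom c x ->
  {for cmap c x, continuous (gram g c \o cinv c)}.
Proof. by move=> Sc cx; apply: (gram_smooth g Sc 0); exact: cmap_cdom. Qed.

Lemma tnorm_lower_bound c x : atlas S c -> cdom c x ->
  exists2 k : R, 0 < k & \forall y \near cmap c x, forall v,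
    k * `|v| <= tnorm g c (cinv c y) v.
Proof.
move=> Sc cx; have [|k k0 H] := posdef_lower_bound (gram_continuous Sc cx).
  by move=> v; rewrite /= cmapK//; exact: gram_posdef.
exists k => //; apply: filterS H => y H v.
rewrite -[leLHS]ger0_norm ?mulr_ge0 ?(ltW k0)// -sqrtr_sqr ler_wsqrtr//.
Qed.

Lemma tnorm_upper_bound c x : atlas S c -> cdom c x ->
  exists2 k : R, 0 < k & \forall y \near cmap c x, forall v,
    tnorm g c (cinv c y) v <= k * `|v|.
Proof.
move=> Sc cx; have [k H] := quad_form_upper_bound (gram_continuous Sc cx).
exists (Num.sqrt (`|k| + 1)); first by rewrite sqrtr_gt0 ltr_wpDl.
apply: filterS H => y H v.
rewrite -[X in _ * X]normr_id -[X in _ * X]sqrtr_sqr -sqrtrM ?addr_ge0//.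
rewrite ler_wsqrtr//.
apply: le_trans (H v) _; rewrite ler_wpM2r ?sqr_ge0//.
by apply: le_trans (ler_norm k) _; rewrite lerDl.
Qed.

(** The operator norm of [Df(x)] for the metric is at most [k], kept as inequalities between reals
    so that bounds can be added and passed to limits without extended suprema. *)
Definition diff_bound (n : nat) (f : M -> 'cV[R]_n) (k : R) x :=
  forall c v, atlas S c -> cdom c x ->
    enorm ('d (f \o cinv c) (cmap c x) v) <= k * tnorm g c x v.

Lemma supnormD_fun_le n (f : M -> 'cV[R]_n) (k : R) : 0 <= k ->
  (forall x, diff_bound f k x) -> (supnormD_fun g f <= k%:E)%E.
Proof.
move=> k0 H; apply: nnsup_le => [|_ [c [x [Sc cx ->]]]]; first by rewrite lee_fin.
by apply: opnorm_le => // v; exact: H.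
Qed.

Lemma supnormD_map_bound (phi : M -> M) (k : R) c d x v :
  (supnormD_map g phi <= k%:E)%E ->
  atlas S c -> atlas S d -> cdom c x -> cdom d (phi x) ->
  tnorm g d (phi x) ('d (cmap d \o phi \o cinv c) (cmap c x) v)
    <= k * tnorm g c x v.
Proof.
move=> Hk Sc Sd cx dx; apply: le_opnorm.
- exact: tnorm0.
- by move=> *; exact: tnormZ.
- by move=> w; exact: tnorm_gt0.
- by move=> *; exact: tnormZ.
apply: le_trans Hk; apply: nnsup_ubound.
by exists c, d, x.
Qed.

(** By the chain rule another chart only inserts the differential of the transition map, and
    [gram_change] says that this differential is an isometry between the two coordinate expressions
    of the metric. *)
Lemma diff_bound_chart n (f : M -> 'cV[R]_n) (k : R) c x :
  C1_fun S f -> atlas S c -> cdom c x ->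
  (forall v, enorm ('d (f \o cinv c) (cmap c x) v) <= k * tnorm g c x v) ->
  diff_bound f k x.
Proof.
move=> C1f Sc cx H d v Sd dx.
have dcd : differentiable (cmap c \o cinv d) (cmap d x).
  exact: (C1_at_diff (C1_map_at C1_map_id Sd Sc dx cx)).
have df : differentiable (f \o cinv c) ((cmap c \o cinv d) (cmap d x)).
  by rewrite /= cmapK//; apply/C1_at_diff/(iffLR (C1_funP f)).
have loc : \forall y \near cmap d x,
    ((f \o cinv c) \o (cmap c \o cinv d)) y = (f \o cinv d) y.
  have nc : \forall y \near cmap d x, cdom c (cinv d y).
    exact: (@cinv_cvg d x dx _ (open_nbhs_mem (@cdom_open _ _ _ c) cx)).
  by apply: filterS nc => y cy /=; rewrite cmapK.
have [_ E] := near_eq_diff loc (differentiable_comp dcd df).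
rewrite E.
rewrite (@diff_compE _ _ _ _ (cmap c \o cinv d) (f \o cinv c) (cmap d x) v dcd df).
move: (gram_change g v v Sd Sc dx cx).
have -> : (cmap c \o cinv d) (cmap d x) = cmap c x by rewrite /= cmapK.
move=> gE; apply: le_trans (H _) _.
by rewrite /tnorm gE.
Qed.

Lemma C1_fun_diff_bounded n (f : M -> 'cV[R]_n) : compact [set: M] ->
  C1_fun S f -> exists2 k : R, 0 <= k & forall x, diff_bound f k x.
Proof.
move=> cM C1f; apply: compact_locally_bounded => // [k k' x kk' H c v Sc cx|x].
  by apply: le_trans (H c v Sc cx) _; rewrite ler_wpM2r// tnorm_ge0.
have [c Sc cx] := atlas_cover S x.
have [df cdf] := iffLR (C1_funP f) C1f c x Sc cx.
have [d d0 Hd] := tnorm_lower_bound Sc cx.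
pose b (j : 'I_m) : R := `|'d (f \o cinv c) (cmap c x) (delta_mx j 0)| + 1.
have Hb : \forall y \near cmap c x, forall j : 'I_m,
    `|'d (f \o cinv c) y (delta_mx j 0)| <= b j.
  apply: (filter_forall (nbhs_filter (cmap c x))) => j.
  by have := cvgr_norm_le _ (cdf (delta_mx j 0)); apply; rewrite ltrDl.
(* The sum of the [b j] bounds the max norm of the image of a vector of max norm 1, [n] passes to
   [enorm], and [1 / d] replaces the max norm of [v] by its [tnorm]. *)
pose k := n%:R * (\sum_j b j) / d.
exists k; apply: filterS (near_cmap cx (filterI Hd Hb)) => z [cz [dz bz]].
apply: (diff_bound_chart C1f Sc cz) => v.
rewrite (cmapK cz) in dz.
have b0 : 0 <= \sum_j b j by rewrite sumr_ge0// => j _; rewrite addr_ge0.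
apply: (@le_trans _ _ (n%:R * (\sum_j b j * `|v|))).
  apply: enorm_le_coord => i; apply: le_trans (coord_le_norm _ _) _.
  rewrite linear_col; apply: le_trans (ler_norm_sum _ _ _) _.
  apply: ler_sum => j _; rewrite normrZ mulrC.
  by apply: ler_pM => //; exact: coord_le_norm.
rewrite -mulr_suml /k -!mulrA ler_wpM2l// ler_wpM2l//.
by rewrite mulrC ler_pdivlMr// mulrC.
Qed.

Lemma C1_fun_bounded n (f : M -> 'cV[R]_n) : compact [set: M] ->
  C1_fun S f -> exists2 k : R, 0 <= k & forall x, enorm (f x) <= k.
Proof.
move=> cM C1f; apply: compact_locally_bounded => // [k k' x kk'|x].
  by move=> /le_trans; apply.
have [c Sc cx] := atlas_cover S x.
have C1c := iffLR (C1_funP f) C1f c x Sc cx.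
have H : \forall y \near cmap c x, `|(f \o cinv c) y| <= `|(f \o cinv c) (cmap c x)| + 1.
  by have := cvgr_norm_le _ (C1_at_continuous C1c); apply; rewrite ltrDl.
exists (n%:R * (`|(f \o cinv c) (cmap c x)| + 1)).
apply: filterS (near_cmap cx H) => z [cz]; rewrite /= cmapK// => fz.
by apply: enorm_le_coord => i; exact: le_trans (coord_le_norm _ _) fz.
Qed.

End Manifold.

(** * The echo state operator *)

Lemma geometric_small (R : realType) (q b e : R) :
  0 <= q < 1 -> 0 < e -> exists N, q ^+ N * b <= e.
Proof.
move=> /andP[q0 q1] e0.
have /cvgrPdist_le /(_ _ e0) [N _ HN] : (fun k => b * q ^+ k) @ \oo --> (0 : R).
  by apply: cvg_geometric; rewrite ger0_norm.
exists N; have := HN N (leqnn N).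
by rewrite /= sub0r normrN mulrC; apply: le_trans; exact: ler_norm.
Qed.

Lemma cvg_enorm (R : realType) n (v_ : nat -> 'cV[R]_n) (v : 'cV[R]_n) :
  (forall i, v_ k i 0 @[k --> \oo] --> v i 0) ->
  enorm (v_ k) @[k --> \oo] --> enorm v.
Proof.
move=> vl.
apply: (@cvg_comp _ _ _ (fun k => \sum_i v_ k i 0 ^+ 2) Num.sqrt _
  (nbhs (\sum_i v i 0 ^+ 2))); last exact: sqrt_continuous.
apply: (cvg_sum_fin (F := \oo)) => i.
by under eq_fun do rewrite expr2; rewrite expr2; apply: cvgM; exact: vl.
Qed.

Lemma enorm_lim_le (R : realType) n (v_ : nat -> 'cV[R]_n) (v : 'cV[R]_n) w (k : R) N :
  (forall i, v_ l i 0 @[l --> \oo] --> v i 0) ->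
  (forall l, (N <= l)%N -> enorm (w - v_ l) <= k) -> enorm (w - v) <= k.
Proof.
move=> vl H.
have cl : enorm (w - v_ l) @[l --> \oo] --> enorm (w - v).
  apply: cvg_enorm => i; rewrite !mxE; under eq_fun do rewrite !mxE.
  by apply: cvgB; [exact: cvg_cst | exact: vl].
rewrite -(cvg_lim (@Rhausdorff R) cl); apply: limr_le; first exact: cvgP cl.
by exists N => // l /= Nl; exact: H.
Qed.

(** * The coordinatewise nonlinearity, whose Jacobian is diagonal *)

Section Nonlinearity.
Context {R : realType} {n : nat}.
Variables (sigma : R -> R) (b : 'I_n -> R) (vphi : 'cV[R]_n -> 'cV[R]_n).
Hypothesis sigmaP : activation sigma.
Hypothesis vphiE : forall r i, vphi r i 0 = sigma (r i 0 + b i).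

Lemma nonlinearity_lipschitz r s : enorm (vphi r - vphi s) <= enorm (r - s).
Proof.
apply: ler_enorm => i; rewrite !mxE !vphiE.
apply: le_trans (activation_lipschitz sigmaP _ _) _.
by rewrite le_eqVlt; apply/orP; left; apply/eqP; congr `|_|; ring.
Qed.

Let shift_coord i (r : 'cV[R]_n) : R := r i 0 + b i.

Let shift_coord_continuous i : continuous (shift_coord i).
Proof.
move=> r; apply: (@cvgD _ _ _ (nbhs r) _ (fun r : 'cV[R]_n => r i 0) (fun=> b i)).
  exact: coord_continuous.
exact: cvg_cst.
Qed.

Let diff_shift_coord i r : differentiable (shift_coord i) r /\
  forall v, 'd (shift_coord i) r v = v i 0.
Proof.
have d1 := differentiable_coord r i 0.
have d2 : differentiable (cst (b i) : 'cV[R]_n -> R) r by exact: differentiable_cst.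
split=> [|v]; first exact: (differentiableD d1 d2).
have E1 := congr1 (@^~ v) (diffD d1 d2).
have E2 := congr1 (@^~ v) (diff_cst (b i) r).
apply: (eq_trans E1); rewrite /= [X in _ + X]E2.
by rewrite addr0 (@diff_col _ _ _ id)// diff_val.
Qed.

Lemma nonlinearity_diff r : differentiable vphi r.
Proof.
apply: differentiable_col => i.
rewrite (_ : (fun y => _) = sigma \o shift_coord i); last first.
  by apply/funext => y; rewrite vphiE.
apply: differentiable_comp; first by have [] := diff_shift_coord i r.
by apply/derivable1_diffP; case: sigmaP.
Qed.

Lemma nonlinearity_diffE r v i :
  'd vphi r v i 0 = derive1 sigma (r i 0 + b i) * v i 0.
Proof.
rewrite -diff_col; last exact: nonlinearity_diff.
rewrite (_ : (fun y => _) = sigma \o shift_coord i); last first.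
  by apply/funext => y; rewrite vphiE.
have [ds dsE] := diff_shift_coord i r.
have dsig : derivable sigma (shift_coord i r) 1 by case: sigmaP.
rewrite (@diff_compE _ _ _ _ (shift_coord i) sigma)//; last exact/derivable1_diffP.
by rewrite dsE (deriv1E dsig)/= mulrC.
Qed.

Lemma nonlinearity_C1 r : C1_at vphi r.
Proof.
split=> [|v]; first by near=> y; exact: nonlinearity_diff.
apply: (cvg_col (F := nbhs r)) => i.
apply: (@near_eq_continuous _ _
  (fun y => derive1 sigma (shift_coord i y) * v i 0) (fun y => 'd vphi y v i 0)).
  by near=> y; rewrite nonlinearity_diffE.
apply: (@cvgM _ _ (nbhs r) _ (derive1 sigma \o shift_coord i)); last exact: cvg_cst.
apply: continuous_comp; first exact: shift_coord_continuous.
by case: sigmaP => _ + _ _; apply.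
Unshelve. all: by end_near. Qed.

End Nonlinearity.

Lemma eq_enorm_le (R : realType) n (v w : 'cV[R]_n) (k : R) :
  v = w -> enorm w <= k -> enorm v <= k.
Proof. by move=> ->. Qed.

(** Split [s (P + I) - t (Q + I)] as [(s - t) (P + I) + t (P - Q)]. Below, [s] and [t] are the
    diagonals of the Jacobian of the nonlinearity, [P] and [Q] the parts carrying [Df] and [Dh], and
    [I] the common input derivative. *)
Lemma enorm_scaled_sub_le (R : realType) n (p q P Q I : 'cV[R]_n)
    (s t : 'I_n -> R) (e : R) : 0 <= e ->
  (forall i, p i 0 = s i * (P + I) i 0) ->
  (forall i, q i 0 = t i * (Q + I) i 0) ->
  (forall i, `|s i - t i| <= e) -> (forall i, `|t i| <= 1) ->
  enorm (p - q) <= e * enorm (P + I) + enorm (P - Q).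
Proof.
move=> e0 pE qE st t1.
have -> : p - q = (\col_i ((s i - t i) * (P + I) i 0)) + \col_i (t i * (P - Q) i 0).
  by apply/colP => i; rewrite mxE [X in _ + X]mxE pE qE !mxE; ring.
apply: le_trans (ler_enormD _ _) _; apply: lerD; last first.
  by apply: ler_enorm => i; rewrite mxE normrM ler_piMl.
rewrite -[X in X * _](ger0_norm e0) -enormZ; apply: ler_enorm => i.
by rewrite mxE [X in _ <= `|X|]mxE !normrM (ger0_norm e0) ler_wpM2r.
Qed.

(** * The operator and its iterates, with real bounds [a] for the matrix and [L] for the inverse
    diffeomorphism *)

Section EchoState.
Context {R : realType} {m n : nat} {M : topologicalType}.
Variables (S : manifold R m M) (g : riemannian_metric S).
Variables (phi : diffeo1 S) (omega : M -> R) (E : ESN R n).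
Variables (sigma : R -> R) (b : 'I_n -> R).
Hypothesis sigmaP : activation sigma.
Hypothesis vphiE : forall r i, esn_phi E r i 0 = sigma (r i 0 + b i).
Variables a L : R.
Hypothesis a_ge0 : 0 <= a.
Hypothesis a_lt1 : a < 1.
Hypothesis L_ge0 : 0 <= L.
Hypothesis aL_lt1 : a * L < 1.
Hypothesis A_le : forall v, enorm (esn_A E *m v) <= a * enorm v.
Hypothesis phi_le : forall c d x v, atlas S c -> atlas S d ->
  cdom c x -> cdom d (diff_inv phi x) ->
  tnorm g d (diff_inv phi x) ('d (cmap d \o diff_inv phi \o cinv c) (cmap c x) v)
    <= L * tnorm g c x v.
Hypothesis M_compact : compact [set: M].
Hypothesis omega_C1 : C1_fun S omega.

Let psi := diff_inv phi.
Let T := esn_op E phi omega.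
Let u := esn_seq E phi omega.
Let input (x : M) : 'cV[R]_n := omega x *: esn_Win E.
Let Y (f : M -> 'cV[R]_n) x : 'cV[R]_n := esn_A E *m f (psi x) + input x.

Let input_C1 : C1_fun S input.
Proof.
apply/C1_funP => c x Sc cx.
exact: C1_at_scalel (iffLR (C1_funP S omega) omega_C1 c x Sc cx).
Qed.

Let C1f_at (V : normedModType R) (f : M -> V) (C1f : C1_fun S f) c x
  (Sc : atlas S c) (cx : cdom c x) : C1_at (f \o cinv c) (cmap c x) :=
  iffLR (C1_funP S f) C1f c x Sc cx.

Lemma esn_op_contraction f h x :
  enorm (T f x - T h x) <= a * enorm (f (psi x) - h (psi x)).
Proof.
apply: le_trans (nonlinearity_lipschitz sigmaP vphiE _ _) _.
by rewrite opprD addrACA subrr addr0 -mulmxBr; exact: A_le.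
Qed.

Section Derivative.
Variables (f : M -> 'cV[R]_n).
Hypothesis C1f : C1_fun S f.
Variables (c d : chart R m M) (x : M).
Hypotheses (Sc : atlas S c) (Sd : atlas S d) (cx : cdom c x) (dx : cdom d (psi x)).

Let back := cmap d \o psi \o cinv c.
(** The argument of [esn_phi], read in the chart [c] and routed through the chart [d] at [psi x], so
    that only maps between vector spaces are composed. It is faithful near [cmap c x], where [psi]
    stays in [cdom d]. *)
Let pre (y : 'cV[R]_m) : 'cV[R]_n :=
  (mulmx (esn_A E) \o ((f \o cinv d) \o back)) y + (input \o cinv c) y.

Let back_x : back (cmap c x) = cmap d (psi x).
Proof. by rewrite /back/= cmapK. Qed.

Let back_C1 : C1_at back (cmap c x).
Proof. exact: (C1_map_at (diff_inv_C1 phi) Sc Sd cx dx). Qed.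

Let fback_C1 : C1_at ((f \o cinv d) \o back) (cmap c x).
Proof. by apply: C1_at_comp => //; rewrite back_x; exact: C1f_at. Qed.

Let Afback_C1 : C1_at (mulmx (esn_A E) \o ((f \o cinv d) \o back)) (cmap c x).
Proof. by apply: C1_at_comp => //; exact: C1_at_linear. Qed.

Let pre_C1 : C1_at pre (cmap c x).
Proof. exact: C1_at_add Afback_C1 (C1f_at input_C1 Sc cx). Qed.

Let pre_x : pre (cmap c x) = Y f x.
Proof.
have E1 : pre (cmap c x) =
  esn_A E *m f (cinv d (back (cmap c x))) + input (cinv c (cmap c x)) by [].
by rewrite E1 back_x !cmapK.
Qed.

Let pre_near : \forall y \near cmap c x,
  (esn_phi E \o pre) y = (T f \o cinv c) y.
Proof.
have cc : psi \o cinv c @ cmap c x --> psi x.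
  exact: cvg_comp (@cinv_cvg _ _ _ c x cx) ((diff_inv_C1 phi).1 x).
have nd : \forall y \near cmap c x, cdom d (psi (cinv c y)).
  exact: (cc _ (open_nbhs_mem (@cdom_open _ _ _ d) dx)).
by apply: filterS nd => y dy; rewrite /pre /back /= cmapK.
Qed.

Lemma esn_op_C1_at : C1_at (T f \o cinv c) (cmap c x).
Proof.
apply: near_eq_C1_at pre_near _; apply: C1_at_comp => //.
exact: nonlinearity_C1 sigmaP vphiE _.
Qed.

Lemma esn_op_diff v i :
  'd (T f \o cinv c) (cmap c x) v i 0 = derive1 sigma (Y f x i 0 + b i) *
    (esn_A E *m 'd (f \o cinv d) (cmap d (psi x)) ('d back (cmap c x) v)
     + 'd (input \o cinv c) (cmap c x) v) i 0.
Proof.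
have dpre := C1_at_diff pre_C1.
have dphi := nonlinearity_diff sigmaP vphiE (pre (cmap c x)).
have [_ E1] := near_eq_diff pre_near (differentiable_comp dpre dphi).
(* Chained by [eq_trans]: keyed [rewrite] diverges here, by unfolding ['d]. *)
apply: (eq_trans (congr1 (fun w : 'cV[R]_m -> 'cV[R]_n => w v i 0) E1)).
apply: (eq_trans (congr1 (fun w : 'cV[R]_n => w i 0) (diff_compE v dpre dphi))).
apply: (eq_trans (nonlinearity_diffE sigmaP vphiE _ _ _)).
rewrite pre_x; congr (_ * fun_of_matrix _ i 0).
have dA := C1_at_diff Afback_C1.
have dI := C1_at_diff (C1f_at input_C1 Sc cx).
apply: (eq_trans (congr1 (@^~ v) (diffD dA dI))) => /=; congr (_ + _).
have dfb := C1_at_diff fback_C1.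
have dM : differentiable (mulmx (esn_A E)) (((f \o cinv d) \o back) (cmap c x)).
  exact: (C1_at_diff (C1_at_linear (mulmx (esn_A E)) _)).
apply: (eq_trans (diff_compE v dfb dM)).
have cM := @linear_col_continuous _ _ _ (mulmx (esn_A E)).
apply: (eq_trans (congr1 (@^~ _) (diff_lin _ cM))).
congr (_ *m _).
have df : differentiable (f \o cinv d) (back (cmap c x)).
  by rewrite back_x; exact: (C1_at_diff (C1f_at C1f Sd dx)).
apply: (eq_trans (diff_compE v (C1_at_diff back_C1) df)).
exact: (congr1 (fun z => 'd (f \o cinv d) z ('d back (cmap c x) v)) back_x).
Qed.

End Derivative.

Lemma esn_op_C1 (f : M -> 'cV[R]_n) : C1_fun S f -> C1_fun S (T f).
Proof.
move=> C1f; apply/C1_funP => c x Sc cx.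
have [d Sd dx] := atlas_cover S (psi x).
exact: (esn_op_C1_at C1f Sc Sd cx dx).
Qed.

Let sub_diff (f h : M -> 'cV[R]_n) c x v :
  C1_fun S f -> C1_fun S h -> atlas S c -> cdom c x ->
  'd ((fun y => f y - h y) \o cinv c) (cmap c x) v =
  'd (f \o cinv c) (cmap c x) v - 'd (h \o cinv c) (cmap c x) v.
Proof.
move=> C1f C1h Sc cx.
have df := C1_at_diff (C1f_at C1f Sc cx); have dh := C1_at_diff (C1f_at C1h Sc cx).
exact: (congr1 (@^~ v) (diffB df dh)).
Qed.

Let sub_diff_boundP (f h : M -> 'cV[R]_n) k x : C1_fun S f -> C1_fun S h ->
  diff_bound g (fun y => f y - h y) k x <->
  forall c v, atlas S c -> cdom c x ->
    enorm ('d (f \o cinv c) (cmap c x) v - 'd (h \o cinv c) (cmap c x) v)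
      <= k * tnorm g c x v.
Proof.
move=> C1f C1h; split=> H c v Sc cx; have E1 := @sub_diff f h c x v C1f C1h Sc cx.
  exact: (eq_enorm_le (esym E1) (H c v Sc cx)).
exact: (eq_enorm_le E1 (H c v Sc cx)).
Qed.

Variable W : R.
Hypothesis W_ge0 : 0 <= W.
Hypothesis input_diff : forall x, diff_bound g input W x.

Let chain (f : M -> 'cV[R]_n) (c d : chart R m M) x v : 'cV[R]_n :=
  esn_A E *m 'd (f \o cinv d) (cmap d (psi x))
    ('d (cmap d \o psi \o cinv c) (cmap c x) v).

Let chain_le (f : M -> 'cV[R]_n) C c d x v : 0 <= C -> (forall y, diff_bound g f C y) ->
  atlas S c -> atlas S d -> cdom c x -> cdom d (psi x) ->
  enorm (chain f c d x v) <= a * L * C * tnorm g c x v.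
Proof.
move=> C0 fC Sc Sd cx dx.
apply: le_trans (A_le _) _; rewrite -!mulrA ler_wpM2l//.
apply: le_trans (fC (psi x) d _ Sd dx) _.
by rewrite mulrCA ler_wpM2l// phi_le.
Qed.

(** As sigma' lies in (0, 1), the diagonal factor shrinks every coordinate; the factors [a], [L] and
    [C] come from the matrix, [psi] and [f]. *)
Lemma esn_op_diff_bound (f : M -> 'cV[R]_n) C : C1_fun S f -> 0 <= C ->
  (forall x, diff_bound g f C x) ->
  forall x, diff_bound g (T f) (a * L * C + W) x.
Proof.
move=> C1f C0 fC x c v Sc cx.
have [d Sd dx] := atlas_cover S (psi x).
apply: (@le_trans _ _ (enorm (chain f c d x v + 'd (input \o cinv c) (cmap c x) v))).
  apply: ler_enorm => i; rewrite (esn_op_diff C1f Sc Sd cx dx).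
  case: sigmaP => _ _ _ /(_ (Y f x i 0 + b i)) /andP[s0 s1].
  by rewrite normrM ler_piMl// ger0_norm ltW.
apply: le_trans (ler_enormD _ _) _; rewrite mulrDl lerD//; last exact: input_diff.
exact: chain_le.
Qed.

(** The gap [e] of sigma' multiplies the derivative of [f], hence the bound [C] on that side, while
    the difference of derivatives contracts by [a * L]. *)
Lemma esn_op_sub_diff_bound (f h : M -> 'cV[R]_n) C B e : C1_fun S f -> C1_fun S h ->
  0 <= C -> 0 <= B -> 0 <= e ->
  (forall x, diff_bound g f C x) ->
  (forall x, diff_bound g (fun y => f y - h y) B x) ->
  (forall x i, `|derive1 sigma (Y f x i 0 + b i)
                 - derive1 sigma (Y h x i 0 + b i)| <= e) ->
  forall x, diff_bound g (fun y => T f y - T h y) (e * (a * L * C + W) + a * L * B) x.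
Proof.
move=> C1f C1h C0 B0 e0 fC fhB se x c v Sc cx.
have [d Sd dx] := atlas_cover S (psi x).
rewrite (@sub_diff (T f) (T h) c x v (esn_op_C1 C1f) (esn_op_C1 C1h) Sc cx).
pose s (k : M -> 'cV[R]_n) i := derive1 sigma (Y k x i 0 + b i).
pose I := 'd (input \o cinv c) (cmap c x) v.
have chain_sub : chain (fun y => f y - h y) c d x v = chain f c d x v - chain h c d x v.
  have E1 := @sub_diff f h d (psi x) ('d (cmap d \o psi \o cinv c) (cmap c x) v)
    C1f C1h Sd dx.
  exact: (eq_trans (congr1 (mulmx (esn_A E)) E1) (mulmxBr _ _ _)).
have t1 i : `|s h i| <= 1.
  case: sigmaP => _ _ _ /(_ (Y h x i 0 + b i)) /andP[s0 s1].
  by rewrite ger0_norm ltW.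
have := enorm_scaled_sub_le e0 (fun i => esn_op_diff C1f Sc Sd cx dx v i)
  (fun i => esn_op_diff C1h Sc Sd cx dx v i) (se x) t1.
move=> /le_trans; apply.
rewrite mulrDl lerD//; last first.
  by have := chain_le v B0 fhB Sc Sd cx dx; rewrite chain_sub.
rewrite -[leRHS]mulrA ler_wpM2l//; apply: le_trans (ler_enormD _ _) _.
by rewrite mulrDl lerD//; [exact: chain_le | exact: input_diff].
Qed.

(** * Cauchy estimates for the iterates and their derivatives; uniqueness of the fixed point *)

Variable r0 : 'cV[R]_n.
Hypothesis r0_cube : cube r0.

Lemma esn_seq_C1 k : C1_fun S (u r0 k).
Proof.
elim: k => [|k IH]; last exact: esn_op_C1.
by apply/C1_funP => c x Sc cx; exact: C1_at_cst.
Qed.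

Let cube_enorm (v : 'cV[R]_n) : cube v -> enorm v <= n%:R.
Proof.
move=> cv; rewrite -[leRHS]mulr1; apply: enorm_le_coord => i.
by rewrite ler_norml; exact: cv.
Qed.

Let esn_op_cube f x : cube (T f x).
Proof.
move=> i; rewrite /T /esn_op vphiE.
by case: sigmaP => _ _ /(_ (Y f x i 0 + b i)) /andP[? ?] _; rewrite !ltW.
Qed.

Let esn_seq_cube k x : cube (u r0 k x).
Proof. by case: k => [|k]; [exact: r0_cube | exact: esn_op_cube]. Qed.

Let cube_sub (v w : 'cV[R]_n) : cube v -> cube w -> enorm (v - w) <= n%:R + n%:R.
Proof.
move=> cv cw; apply: le_trans (ler_enormD _ _) _.
by rewrite enormN lerD// cube_enorm.
Qed.

(** Both indices are at least [N], so [N] contractions can be peeled off before comparing two points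
    of the cube, at distance at most [2 n]. No telescoping sum arises. *)
Lemma esn_seq_cauchy N k l x : (N <= k)%N -> (N <= l)%N ->
  enorm (u r0 k x - u r0 l x) <= a ^+ N * (n%:R + n%:R).
Proof.
elim: N k l x => [|N IH] [|k] [|l] x // Nk Nl; rewrite ?mul1r;
  try by apply: cube_sub; exact: esn_seq_cube.
apply: le_trans (esn_op_contraction _ _ _) _.
by rewrite exprS -mulrA ler_wpM2l//; exact: IH.
Qed.

(** A fixed point lies in the range of [T], hence takes values in the cube. This gives an a priori
    bound on the distance, which is then contracted [N] times. *)
Lemma esn_op_fixed_unique f h : f = T f -> h = T h -> h = f.
Proof.
move=> fE hE.
have le N x : enorm (h x - f x) <= a ^+ N * (n%:R + n%:R).
  elim: N x => [|N IH] x.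
    by rewrite mul1r fE hE; apply: cube_sub; exact: esn_op_cube.
  rewrite hE fE; apply: le_trans (esn_op_contraction _ _ _) _.
  by rewrite exprS -mulrA ler_wpM2l.
apply/funext => x; apply/subr0_eq/colP => i; rewrite [RHS]mxE.
apply: enorm0_eq0; apply/eqP; rewrite eq_le enorm_ge0 andbT.
apply/ler_addgt0Pr => e e0; rewrite add0r.
have [|N] := @geometric_small R a (n%:R + n%:R) e _ e0; first by rewrite a_ge0.
by apply: le_trans; exact: le.
Qed.

(** The fixed point of the affine recursion [C |-> a * L * C + W] for derivative bounds. *)
Let C := W / (1 - a * L).

Let C_ge0 : 0 <= C.
Proof. by rewrite divr_ge0// subr_ge0 ltW. Qed.

Let C_fixed : a * L * C + W = C.
Proof. by rewrite /C; field; rewrite subr_eq0 gt_eqF. Qed.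

Lemma esn_seq_diff_bound k x : diff_bound g (u r0 k) C x.
Proof.
elim: k x => [|k IH] x; last first.
  rewrite -C_fixed; apply: esn_op_diff_bound.
  - exact: esn_seq_C1.
  - exact: C_ge0.
  - exact: IH.
move=> c v Sc cx; have -> : u r0 0%N \o cinv c = cst r0 by [].
rewrite (congr1 (@^~ v) (diff_cst r0 (cmap c x))) enorm0.
by rewrite mulr_ge0// tnorm_ge0.
Qed.

Let derive_gap e : 0 < e -> exists N, forall k l, (N <= k)%N -> (N <= l)%N ->
  forall x i, `|derive1 sigma (Y (u r0 k) x i 0 + b i)
              - derive1 sigma (Y (u r0 l) x i 0 + b i)| <= e.
Proof.
move=> e0; have [w w0 inputw] := C1_fun_bounded M_compact input_C1.
(* The segment contains every argument of sigma along the sequence: [a * n] bounds the matrix term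
   on the cube, [w] the input, and the sum any single bias. *)
have [d d0 Hd] := activation_derive_unif sigmaP (a * n%:R + w + \sum_i `|b i|) e0.
have [|N HN] := @geometric_small R a (n%:R + n%:R) d _ d0; first by rewrite a_ge0.
exists N => k l Nk Nl x i; apply: Hd.
  apply: le_trans (ler_normD _ _) _; apply: lerD; last first.
    by rewrite (bigD1 i)//= lerDl sumr_ge0.
  apply: le_trans (coord_le_enorm _ _) _.
  apply: le_trans (ler_enormD _ _) _; apply: lerD; last exact: inputw.
  by apply: le_trans (A_le _) _; rewrite ler_wpM2l// cube_enorm//; exact: esn_seq_cube.
have -> : Y (u r0 k) x i 0 + b i - (Y (u r0 l) x i 0 + b i) =
    (esn_A E *m (u r0 k (psi x) - u r0 l (psi x))) i 0.
  by rewrite mulmxBr !mxE; ring.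
apply: le_trans (coord_le_enorm _ _) _; apply: le_trans (A_le _) _.
apply: le_trans (ler_piMl (enorm_ge0 _) (ltW a_lt1)) _.
by apply: le_trans HN; exact: esn_seq_cauchy.
Qed.

Lemma esn_seq_diff_cauchy e : 0 < e -> exists N, forall k l,
  (N <= k)%N -> (N <= l)%N ->
  forall x, diff_bound g (fun y => u r0 k y - u r0 l y) e x.
Proof.
move=> e0; have mu0 : 0 <= a * L by rewrite mulr_ge0.
(* One step turns the error [e / 2] into [e1 * C + a * L * (e / 2)]; this choice of [e1] makes it at
   most [e / 2] again. The [+ 1] covers [C = 0]. *)
have e1 : 0 < e * (1 - a * L) / (2 * (C + 1)).
  by rewrite divr_gt0 ?mulr_gt0 ?subr_gt0// ltr_wpDl.
have ratio (X K : R) : 0 <= X -> 0 <= K -> X / (2 * (K + 1)) * K <= X / 2.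
  move=> X0 K0; have K1 : 0 < K + 1 by rewrite ltr_wpDl.
  have -> : X / (2 * (K + 1)) * K = X / 2 * (K / (K + 1)).
    by field; rewrite gt_eqF.
  by rewrite ler_piMr ?divr_ge0// ler_pdivrMr// mul1r lerDl.
have [N0 HN0] := derive_gap e1.
(* [j] counts the contractions made beyond [N0]; at [j = 0] both derivatives are simply bounded by
   [C]. *)
have step j k l : (N0 + j <= k)%N -> (N0 + j <= l)%N -> forall x,
    diff_bound g (fun y => u r0 k y - u r0 l y) (e / 2 + (a * L) ^+ j * (C + C)) x.
  elim: j k l => [|j IH] k l Nk Nl x.
    move=> c v Sc cx.
    rewrite (@sub_diff (u r0 k) (u r0 l) c x v (esn_seq_C1 k) (esn_seq_C1 l) Sc cx).
    apply: le_trans (ler_enormD _ _) _; rewrite enormN expr0 mul1r.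
    have := @esn_seq_diff_bound k x c v Sc cx; have := @esn_seq_diff_bound l x c v Sc cx.
    have := tnorm_ge0 g c x v; move=> t0 h1 h2.
    apply: (le_trans (lerD h2 h1)); rewrite -mulrDl ler_wpM2r// lerDr.
    by rewrite ltW// divr_gt0.
  case: k Nk => [|k] Nk; first by rewrite addnS in Nk.
  case: l Nl => [|l] Nl; first by rewrite addnS in Nl.
  rewrite addnS ltnS in Nk; rewrite addnS ltnS in Nl.
  have B0 : 0 <= e / 2 + (a * L) ^+ j * (C + C).
    by rewrite addr_ge0 ?mulr_ge0 ?exprn_ge0 ?addr_ge0// ltW.
  have H := esn_op_sub_diff_bound (esn_seq_C1 k) (esn_seq_C1 l) C_ge0 B0 (ltW e1)
    (esn_seq_diff_bound k) (IH k l Nk Nl)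
    (HN0 k l (leq_trans (leq_addr _ _) Nk) (leq_trans (leq_addr _ _) Nl)).
  move=> c v Sc cx; apply: le_trans (H x c v Sc cx) _.
  rewrite ler_wpM2r ?tnorm_ge0// C_fixed.
  have : e * (1 - a * L) / (2 * (C + 1)) * C <= e * (1 - a * L) / 2.
    by apply: ratio => //; rewrite mulr_ge0 ?subr_ge0// ltW.
  rewrite exprS => h.
  apply: le_trans (lerD h (lexx _)) _.
  by rewrite le_eqVlt; apply/orP; left; apply/eqP; field.
have [||j Hj] := @geometric_small R (a * L) (C + C) (e / 2).
- by rewrite mu0.
- by rewrite divr_gt0.
exists (N0 + j)%N => k l Nk Nl x c v Sc cx.
apply: le_trans (step j k l Nk Nl x c v Sc cx) _.
by rewrite ler_wpM2r ?tnorm_ge0//; lra.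
Qed.

(** * The limit: fixed point property, regularity and convergence *)

Definition esn_limit (x : M) : 'cV[R]_n := \col_i limn (fun k => u r0 k x i 0).
Let f := esn_limit.

Lemma esn_seq_cvg x i : u r0 k x i 0 @[k --> \oo] --> f x i 0.
Proof.
rewrite mxE; apply/cauchy_cvgP/cauchy_exP => e e0.
have e2 : 0 < e / 2 by rewrite divr_gt0.
have [|N HN] := @geometric_small R a (n%:R + n%:R) (e / 2) _ e2.
  by rewrite a_ge0.
exists (u r0 N x i 0); exists N => // k /= Nk; rewrite -ball_normE /=.
have -> : u r0 N x i 0 - u r0 k x i 0 = (u r0 N x - u r0 k x) i 0 by rewrite !mxE.
apply: le_lt_trans (coord_le_enorm _ _) _.
apply: le_lt_trans (esn_seq_cauchy x (leqnn N) Nk) _.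
by apply: le_lt_trans HN _; lra.
Qed.

Lemma esn_seq_dist N k x : (N <= k)%N ->
  enorm (u r0 k x - f x) <= a ^+ N * (n%:R + n%:R).
Proof.
move=> Nk; apply: (@enorm_lim_le _ _ (fun l => u r0 l x) _ _ _ N) => [i|l Nl].
  exact: esn_seq_cvg.
exact: esn_seq_cauchy.
Qed.

Lemma esn_limit_fixed : f = T f.
Proof.
apply/funext => x; apply/esym/subr0_eq/colP => i; rewrite [RHS]mxE.
apply: enorm0_eq0; apply/eqP; rewrite eq_le enorm_ge0 andbT.
apply/ler_addgt0Pr => e e0; rewrite add0r.
have e2 : 0 < e / 2 by rewrite divr_gt0.
have [|N HN] := @geometric_small R a (n%:R + n%:R) (e / 2) _ e2.
  by rewrite a_ge0.
have -> : T f x - f x = - (u r0 N.+1 x - T f x) + (u r0 N.+1 x - f x).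
  by rewrite opprB addrA subrK.
apply: le_trans (ler_enormD _ _) _; rewrite enormN.
have -> : e = e / 2 + e / 2 by field.
apply: lerD; last exact: le_trans (esn_seq_dist x (leqnSn N)) HN.
apply: le_trans (esn_op_contraction (u r0 N) f x) _.
apply: le_trans (ler_piMl (enorm_ge0 _) (ltW a_lt1)) _.
exact: le_trans (esn_seq_dist _ (leqnn N)) HN.
Qed.

(** On a small coordinate ball [tnorm] is at most [K] times the max norm, so the Cauchy estimate
    with [e / K] for the metric is one with [e] for the max norm, and [C1_at_lim] applies to each
    coordinate. *)
Let limit_C1_diff c x : atlas S c -> cdom c x ->
  C1_at (f \o cinv c) (cmap c x) /\
  forall v i, 'd (u r0 k \o cinv c) (cmap c x) v i 0 @[k --> \oo] -->
    'd (f \o cinv c) (cmap c x) v i 0.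
Proof.
move=> Sc cx; have [K K0 HK] := tnorm_upper_bound g Sc cx.
have [r /= r_gt0 Hr] := iffLR (nbhs_ballP _ _) (filterI HK (near_cinv cx)).
have C1u k y : ball (cmap c x) r y -> C1_at (u r0 k \o cinv c) y.
  move=> /Hr[_ [cy yE]]; by have := C1f_at (esn_seq_C1 k) Sc cy; rewrite yE.
have key i : C1_at (fun y => f (cinv c y) i 0) (cmap c x) /\
    forall v, 'd (fun y => u r0 k (cinv c y) i 0) (cmap c x) v @[k --> \oo] -->
      'd (fun y => f (cinv c y) i 0) (cmap c x) v.
  apply: (@C1_at_lim _ _ (fun k y => u r0 k (cinv c y) i 0) _ _ r) => //.
  - exact: linear_col_continuous.
  - by move=> k y By; exact: (iffRL (C1_at_col _ _) (C1u k y By) i).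
  - by move=> y _; exact: esn_seq_cvg.
  move=> e e0; have [N HN] := esn_seq_diff_cauchy (divr_gt0 e0 K0).
  have bound k l z v : (N <= k)%N -> (N <= l)%N -> cdom c z ->
      tnorm g c z v <= K * `|v| ->
      `|'d (fun y => u r0 k (cinv c y) i 0) (cmap c z) v
        - 'd (fun y => u r0 l (cinv c y) i 0) (cmap c z) v| <= e * `|v|.
    move=> Nk Nl cz Kv.
    have dk := C1_at_diff (C1f_at (esn_seq_C1 k) Sc cz).
    have dl := C1_at_diff (C1f_at (esn_seq_C1 l) Sc cz).
    apply: (le_trans (coord_sub_le_enorm (diff_col v i dk) (diff_col v i dl))).
    have H := iffLR (sub_diff_boundP _ _ (esn_seq_C1 k) (esn_seq_C1 l)) (HN k l Nk Nl z).
    apply: (le_trans (H c v Sc cz)).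
    have eK : 0 <= e / K by rewrite divr_ge0// ltW.
    apply: (le_trans (ler_wpM2l eK Kv)).
    by rewrite mulrA divfK ?gt_eqF.
  exists N => k l Nk Nl y v By; have [Ky [cy yE]] := Hr y By.
  by have := bound k l (cinv c y) v Nk Nl cy (Ky v); rewrite yE.
have C1f : C1_at (f \o cinv c) (cmap c x).
  by apply/C1_at_col => i; have [] := key i.
split=> // v i; have [_ /(_ v)] := key i.
have -> : (fun k => 'd (fun y => u r0 k (cinv c y) i 0) (cmap c x) v) =
    (fun k => 'd (u r0 k \o cinv c) (cmap c x) v i 0).
  apply/funext => k; apply: (diff_col v i).
  exact: (C1_at_diff (C1f_at (esn_seq_C1 k) Sc cx)).
by rewrite (diff_col v i (C1_at_diff C1f)).
Qed.

Lemma esn_limit_C1 : C1_fun S f.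
Proof. by apply/C1_funP => c x Sc cx; have [] := limit_C1_diff Sc cx. Qed.

Let diff_bound_limit e : 0 < e -> exists N, forall k, (N <= k)%N ->
  forall x, diff_bound g (fun y => u r0 k y - f y) e x.
Proof.
move=> /esn_seq_diff_cauchy[N HN]; exists N => k Nk x.
apply: (iffRL (sub_diff_boundP _ _ (esn_seq_C1 k) esn_limit_C1)) => c v Sc cx.
have [_ /(_ v) lim_v] := limit_C1_diff Sc cx.
apply: (enorm_lim_le (N := N) lim_v) => l Nl.
have H := iffLR (sub_diff_boundP _ _ (esn_seq_C1 k) (esn_seq_C1 l)) (HN k l Nk Nl x).
exact: (H c v Sc cx).
Qed.

Lemma esn_seq_cvg_C1 : cvg_C1 g (u r0) f.
Proof.
split; [exact: esn_seq_C1 | exact: esn_limit_C1 |].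
pose err k := C1norm g (fun x => u r0 k x - f x).
have norm_ge0 k : (0 <= err k)%E.
  by rewrite adde_ge0// nnsup_ge0.
have norm_le (e : R) : 0 < e -> exists N, forall k, (N <= k)%N ->
    (err k <= (e / 2 + e / 2)%:E)%E.
  move=> e0; have e2 : 0 < e / 2 by rewrite divr_gt0.
  have [|N1 HN1] := @geometric_small R a (n%:R + n%:R) (e / 2) _ e2.
    by rewrite a_ge0.
  have [N2 HN2] := diff_bound_limit e2.
  exists (maxn N1 N2) => k; rewrite geq_max => /andP[k1 k2].
  rewrite EFinD; apply: leeD.
    apply: nnsup_le => [|_ [x _ <-]]; first by rewrite lee_fin ltW.
    by rewrite lee_fin; apply: le_trans HN1; exact: esn_seq_dist.
  by apply: supnormD_fun_le; [exact: ltW | exact: HN2].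
have fin k (e : R) : (err k <= e%:E)%E -> err k \is a fin_num.
  by move=> h; rewrite ge0_fin_numE//; exact: le_lt_trans h (ltry _).
suff : err k @[k --> \oo] --> 0%E by [].
(* The norm is an extended real: it is finite from some index on, and its real part tends to 0. *)
apply/fine_cvgP; split.
  by have [N HN] := norm_le 1 ltr01; exists N => // k /= Nk; exact: fin (HN k Nk).
apply/cvgrPdist_le => e e0; have [N HN] := norm_le e e0.
exists N => // k /= Nk; rewrite sub0r normrN ger0_norm ?fine_ge0//.
have eE : e / 2 + e / 2 = e by field.
have := HN k Nk; rewrite eE => errk.
by rewrite -lee_fin fineK//; exact: fin errk.
Qed.

End EchoState.

(** The inverse of [+oo] is 0, which [0 <= a] rules out. The inverse of 0 is [+oo]; then [L = 0] and
    the product bound is immediate. *)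
Lemma lt_inve_fin (R : realType) (a : R) (s : \bar R) :
  0 <= a -> (0 <= s)%E -> (a%:E < s^-1)%E ->
  exists L : R, [/\ s = L%:E, 0 <= L & a * L < 1].
Proof.
move=> a0; case: s => [L| |] // L0; last by rewrite invey lte_fin ltNge a0.
rewrite lee_fin in L0; have [->|Ln0] := eqVneq L 0.
  by exists 0; rewrite mulr0 lexx ltr01.
rewrite inver (negbTE Ln0) lte_fin => aL; exists L; split=> //.
by rewrite -ltr_pdivlMr ?div1r// lt_def Ln0.
Qed.

Theorem theorem2p2p2 (R : realType) (m n : nat) (M : topologicalType)
    (S : manifold R m M) (g : riemannian_metric S)
    (phi : diffeo1 S) (omega : M -> R) (E : ESN R n)
    (M_compact : compact [set: M])
    (n_gt0 : (0 < n)%N)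
    (omega_C1 : C1_fun S omega)
    (A_small : (mxnorm2 (esn_A E) <
                mine 1 (supnormD_map g (diff_inv phi))^-1)%E) :
  exists f : M -> 'cV[R]_n,
    [/\ C1_fun S f /\ f = esn_op E phi omega f,
        forall h : M -> 'cV[R]_n,
          C1_fun S h -> h = esn_op E phi omega h -> h = f &
        forall r0 : 'cV[R]_n, cube r0 ->
          cvg_C1 g (esn_seq E phi omega r0) f].
Proof.
have [sigma [b [sigmaP vphiE]]] := esn_phiP E.
have A_ge0 : (0 <= mxnorm2 (esn_A E))%E.
  by apply: opnorm_ge0 => [|v]; [exact: enorm0 | exact: enorm_ge0].
move: A_small; rewrite lt_min => /andP[A_lt1 A_ltV].
have A_fin : mxnorm2 (esn_A E) \is a fin_num.
  by rewrite ge0_fin_numE//; exact: lt_trans A_lt1 (ltry _).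
pose a := fine (mxnorm2 (esn_A E)).
have aE : mxnorm2 (esn_A E) = a%:E by rewrite fineK.
have a_ge0 : 0 <= a by rewrite fine_ge0.
have a_lt1 : a < 1 by rewrite -lte_fin -aE.
rewrite aE in A_ltV.
have [L [LE L_ge0 aL_lt1]] := lt_inve_fin a_ge0 (nnsup_ge0 _) A_ltV.
have A_le v : enorm (esn_A E *m v) <= a * enorm v.
  have H : (opnorm (@enorm R n) (@enorm R n) (mulmx (esn_A E)) <= a%:E)%E by rewrite -aE.
  apply: (le_opnorm _ _ _ _ _ H).
  - exact: enorm0.
  - by move=> *; exact: enormZ.
  - move=> w w0; rewrite lt_def enorm_ge0 andbT; apply: contra w0 => /eqP w0.
    by apply/eqP/colP => i; rewrite (enorm0_eq0 w0) mxE.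
  - by move=> *; exact: enormZ.
have phi_le c d x v : atlas S c -> atlas S d ->
    cdom c x -> cdom d (diff_inv phi x) ->
    tnorm g d (diff_inv phi x) ('d (cmap d \o diff_inv phi \o cinv c) (cmap c x) v)
      <= L * tnorm g c x v.
  have sL : (supnormD_map g (diff_inv phi) <= L%:E)%E by rewrite /supnormD_map LE.
  move=> Sc Sd cx dx; exact: (supnormD_map_bound v sL Sc Sd cx dx).
have input_C1 : C1_fun S (fun x => omega x *: esn_Win E).
  apply/C1_funP => c x Sc cx.
  exact: C1_at_scalel (iffLR (C1_funP S omega) omega_C1 c x Sc cx).
have [W W_ge0 input_diff] := C1_fun_diff_bounded g M_compact input_C1.
pose f r0 := esn_limit phi omega E r0.
have fixed r0 : cube r0 -> f r0 = esn_op E phi omega (f r0).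
  by move=> r0P; exact: (esn_limit_fixed phi omega sigmaP vphiE a_ge0 a_lt1 A_le r0P).
have cvg r0 : cube r0 -> cvg_C1 g (esn_seq E phi omega r0) (f r0).
  move=> r0P; exact: (esn_seq_cvg_C1 sigmaP vphiE a_ge0 a_lt1 L_ge0 aL_lt1
    A_le phi_le M_compact omega_C1 W_ge0 input_diff r0P).
have unique h k : h = esn_op E phi omega h -> k = esn_op E phi omega k -> h = k.
  by move=> hE kE; exact: (esn_op_fixed_unique sigmaP vphiE a_ge0 a_lt1 A_le kE hE).
have cube0 : cube (0 : 'cV[R]_n) by move=> i; rewrite mxE lerN10 ler01.
(* The start [0] in the cube supplies the witness; uniqueness identifies it with the limit from any
   other [r0]. *)
exists (f 0); split.
- by split; [have [] := cvg 0 cube0 | exact: fixed].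
- by move=> h _ hE; apply: unique => //; exact: fixed.
- move=> r0 r0P; rewrite (unique (f 0) (f r0)); [exact: cvg| |]; exact: fixed.
Qed.
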